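(* Assume that a $C^1$-smooth closed $n$-dimensional manifold $M^n\subset\mathbb{R}^N$ is essential. Then there exists a closed curve on $M^n$, non-contractible in $M^n$, contained in a cube in $\mathbb{R}^N$ with side length $4W^{l^\infty}_{n-1}(M^n)$ and sides parallel to the coordinate axes.
   Context: A manifold $M^n$ (not simply connected) is called essential if there is no continuous map from $M^n$ to a polyhedron $K$ of dimension at most $n-1$ inducing an isomorphism of fundamental groups. For $x\in\mathbb{R}^N$, $\Vert x\Vert_{l^\infty}=\max_i|x_i|$. For a closed manifold $M^n\subset\mathbb{R}^N$, $W^{l^\infty}_{n-1}(M^n)$ is the infimum, over all $(n-1)$-dimensional polyhedra $K^{n-1}\subset\mathbb{R}^N$ and all continuous maps $\phi:M^n\to K^{n-1}$, of $\sup_{x\in M^n}\Vert x-\phi(x)\Vert_{l^\infty}$. *)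

(* Defs.v *)
From mathcomp Require Import all_boot all_order all_algebra.
From mathcomp Require Import all_classical all_reals all_analysis.
Import numFieldNormedType.Exports.
Set Implicit Arguments. Unset Strict Implicit. Unset Printing Implicit Defensive.
Import Order.TTheory GRing.Theory Num.Theory.
Local Open Scope ring_scope.
Local Open Scope classical_set_scope.

Section Defs.
Variable R : realType.

Definition linf (N : nat) (x : 'rV[R]_N) : R := \big[Num.max/0]_(i < N) `|x 0 i|.

Definition I01 : set R := [set t | 0 <= t <= 1].
Definition sq01 : set (R * R) := [set st | I01 st.1 /\ I01 st.2].

Section Homotopy.
Variable T : topologicalType.

Definition loop_in (X : set T) (g : R -> T) : Prop :=
  {within I01, continuous g} /\ g 0 = g 1 /\ g @` I01 `<=` X.

Definition contractible_in (X : set T) (g : R -> T) : Prop :=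
  exists H : R * R -> T,
    {within sq01, continuous H} /\ H @` sq01 `<=` X /\
    (forall t, I01 t -> H (0, t) = g t /\ H (1, t) = H (1, 0)) /\
    (forall s, I01 s -> H (s, 0) = H (s, 1)).

(* not simply connected (for a connected X): some closed curve is not contractible *)
Definition not_simply_connected (X : set T) : Prop :=
  exists g, loop_in X g /\ ~ contractible_in X g.

Definition homotopic_rel (X : set T) (x0 : T) (g h : R -> T) : Prop :=
  exists H : R * R -> T,
    {within sq01, continuous H} /\ H @` sq01 `<=` X /\
    (forall t, I01 t -> H (0, t) = g t /\ H (1, t) = h t) /\
    (forall s, I01 s -> H (s, 0) = x0 /\ H (s, 1) = x0).

Definition based_loop (X : set T) (x0 : T) (g : R -> T) : Prop :=
  loop_in X g /\ g 0 = x0.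
End Homotopy.

(* phi : X -> Y induces an isomorphism pi_1(X,x0) -> pi_1(Y, phi x0) for every
   base point x0 in X (the induced map [g] |-> [phi o g] is always a group
   homomorphism; we write out that it is injective and surjective). *)
Definition induces_pi1_iso (T U : topologicalType) (X : set T) (Y : set U)
  (phi : T -> U) : Prop :=
  forall x0, X x0 ->
    (forall g h, based_loop X x0 g -> based_loop X x0 h ->
       homotopic_rel Y (phi x0) (phi \o g) (phi \o h) -> homotopic_rel X x0 g h) /\
    (forall k, based_loop Y (phi x0) k ->
       exists g, based_loop X x0 g /\ homotopic_rel Y (phi x0) k (phi \o g)).

Definition aff_indep (m k : nat) (v : 'I_k.+1 -> 'rV[R]_m) : bool :=
  row_free (\matrix_(i < k) (v (lift ord0 i) - v ord0)).

Definition simplex (m k : nat) (v : 'I_k.+1 -> 'rV[R]_m) : set 'rV[R]_m :=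
  [set x | exists t : 'I_k.+1 -> R, (forall i, 0 <= t i) /\
      \sum_(i < k.+1) t i = 1 /\ x = \sum_(i < k.+1) t i *: v i].

Definition polyhedron (m d : nat) (K : set 'rV[R]_m) : Prop :=
  exists (I : Type) (k : I -> nat) (v : forall i : I, 'I_(k i).+1 -> 'rV[R]_m),
    (forall i, (k i <= d)%N) /\ (forall i, aff_indep (v i)) /\
    K = \bigcup_(i in setT) simplex (v i) /\
    (forall r : R, finite_set [set i | exists y, simplex (v i) y /\ linf y <= r]).

Definition C1_embedding_chart (n N : nat) (M U : set 'rV[R]_N)
  (V : set 'rV[R]_n) (f : 'rV[R]_n -> 'rV[R]_N) : Prop :=
  open V /\ {within V, continuous f} /\
  (forall i : 'I_n, (forall x, V x -> derivable f x (delta_mx 0 i)) /\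
     {within V, continuous ('D_(delta_mx 0 i) f)}) /\
  (forall x, V x -> row_free (\matrix_(i < n) ('D_(delta_mx 0 i) f x))) /\
  f @` V = M `&` U /\
  (exists g : 'rV[R]_N -> 'rV[R]_n,
     (forall x, V x -> g (f x) = x) /\ {within M `&` U, continuous g}).

Definition closed_C1_submanifold (n N : nat) (M : set 'rV[R]_N) : Prop :=
  compact M /\
  forall p, M p -> exists (U : set 'rV[R]_N) (V : set 'rV[R]_n) f,
    open U /\ U p /\ C1_embedding_chart M U V f.

Definition essential (n N : nat) (M : set 'rV[R]_N) : Prop :=
  not_simply_connected M /\
  forall (m : nat) (K : set 'rV[R]_m) (phi : 'rV[R]_N -> 'rV[R]_m),
    polyhedron (n.-1) K -> {within M, continuous phi} -> phi @` M `<=` K ->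
    ~ induces_pi1_iso M K phi.

Definition W_linf (n N : nat) (M : set 'rV[R]_N) : R :=
  inf [set r : R | exists (K : set 'rV[R]_N) (phi : 'rV[R]_N -> 'rV[R]_N),
      polyhedron (n.-1) K /\ {within M, continuous phi} /\ phi @` M `<=` K /\
      r = sup [set linf (x - phi x) | x in M]].

End Defs.

(* Main.v *)
(* Let [phi : M -> K] move points by at most [w], where [K] is a polyhedron of
   dimension [d = n - 1].  A cubical grid of small mesh in general position with
   respect to [K] gives open sets of small diameter covering [phi M], coloured by
   [d + 1] colours, with sets of the same colour disjoint.  The path components of
   their preimages form a cover of [M] by path-connected sets [V j] whose nerve has
   dimension at most [d].  If every loop of [M] in a cube of half-side slightly
   larger than [w] were contractible, the map from [M] to the nerve would induce
   an isomorphism of fundamental groups: a homotopy (or loop) in the nerve,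
   subdivided so that each cell lies in a star, is lifted cell by cell, since the
   boundary of each cell goes to a loop near a single fibre of [phi].  This
   contradicts essentiality.  So there are non-contractible loops in cubes of
   half-side [W + eps] for every [eps > 0]; as small loops of [M] are contractible
   this forces [W > 0], and [eps = W] concludes. *)
Require Import Defs.
From mathcomp Require Import all_boot all_order all_algebra.
From mathcomp Require Import all_classical all_reals all_analysis.
From mathcomp Require Import lra.
Import numFieldNormedType.Exports.
Import Order.TTheory GRing.Theory Num.Theory.
Set Implicit Arguments. Unset Strict Implicit. Unset Printing Implicit Defensive.
Local Open Scope ring_scope.
Local Open Scope classical_set_scope.

(** * Continuity on subsets *)

(** The map [phi] cannot be fed to essentiality directly, nor can a map back from [K] to [M] be
    built: loops of [K] need not lift. Pulling a cover back from [K] and splitting it into path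
    components repairs this. Consecutive vertices of a loop in the nerve can then be joined inside a
    single [V j], so surjectivity on fundamental groups needs no smallness of loops; the
    contractibility assumption serves injectivity alone. Splitting does not spoil the dimension
    bound: components of one preimage are equal or disjoint, and preimages of the same colour are
    disjoint.

    The size of the cube comes from injectivity. The loop around a lifted cell stays within two
    steps of the cover from a corner [u], so its image under [phi] stays within twice the mesh of
    [phi u], and the loop itself within [w] plus twice the mesh of [phi u]. The honest half-side is
    thus [W], plus an arbitrarily small excess caused by the mesh and by the infimum. Absorbing this
    excess by [eps = W] is what doubles the side from [2 W] to [4 W]. *)

Lemma within_continuousP (T U : topologicalType) (A : set T) (f : T -> U) :
  {within A, continuous f} <->
  forall x, A x -> forall O, nbhs (f x) O -> nbhs x [set z | A z -> O (f z)].
Proof.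
split => [/subspace_continuousP fA x Ax O fO|fA].
  by have := fA x Ax O fO; rewrite nbhs_simpl.
by apply/subspace_continuousP => x Ax O fO; apply: fA.
Qed.

Lemma eq_within_continuous (T U : topologicalType) (A : set T) (f g : T -> U) :
  (forall x, A x -> f x = g x) -> {within A, continuous f} ->
  {within A, continuous g}.
Proof.
move=> fg /within_continuousP fA; apply/within_continuousP => x Ax O.
rewrite -fg// => /(fA x Ax); apply: filterS => z zO Az.
by rewrite -fg//; exact: zO.
Qed.

Lemma within_continuousW (T U : topologicalType) (A B : set T) (f : T -> U) :
  A `<=` B -> {within B, continuous f} -> {within A, continuous f}.
Proof. by move=> AB; apply: continuous_subspaceW. Qed.

Lemma nbhs_forall (T : topologicalType) (I : finType) (x : T) (P : I -> set T) :
  (forall i, nbhs x (P i)) -> nbhs x [set z | forall i, P i z].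
Proof. exact: filter_forall. Qed.

(** At a given point each piece either contains it, and continuity on the piece applies, or misses a
    neighbourhood of it because the piece is closed; finiteness of [I] allows these neighbourhoods
    to be intersected. *)
Lemma paste_closed (T U : topologicalType) (I : finType) (A : I -> set T) (f : T -> U) :
  (forall i, closed (A i)) -> (forall i, {within A i, continuous f}) ->
  {within \bigcup_i A i, continuous f}.
Proof.
move=> cA fA; apply/within_continuousP => x _ O fO.
have : nbhs x [set z | forall i, A i z -> O (f z)].
  apply: nbhs_forall => i.
  have [Ax|nAx] := pselect (A i x).
    by move/within_continuousP : (fA i) => /(_ x Ax O fO).
  have : nbhs x (~` A i) by apply: open_nbhs_nbhs; split=> //; exact: closed_openC.
  by apply: filterS => z nAz /nAz.
by apply: filterS => z zA [i _ /zA].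
Qed.

Lemma glue_closed (T U : topologicalType) (I : finType) (A : I -> set T)
    (F : I -> T -> U) (u0 : T -> U) :
  (forall i, closed (A i)) -> (forall i, {within A i, continuous F i}) ->
  (forall i j z, A i z -> A j z -> F i z = F j z) ->
  exists G : T -> U, {within \bigcup_i A i, continuous G} /\
    forall i z, A i z -> G z = F i z.
Proof.
move=> cA cF FF.
have /choice[G GF] : forall z, exists u, forall i, A i z -> u = F i z.
  move=> z; have [[i Aiz]|nA] := pselect (exists i, A i z).
    by exists (F i z) => j Ajz; exact: FF.
  by exists (u0 z) => i Aiz; exfalso; apply: nA; exists i.
exists G; split=> [|i z]; last exact: GF.
apply: paste_closed => // i; apply: eq_within_continuous (cF i) => z Aiz.
by rewrite (GF z i).
Qed.

(** A continuous map from a compact set to a Hausdorff space is closed: the part of [A] sent by [h]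
    outside an open set is compact, so its image under [q] is closed, and the complement of that
    image is the required neighbourhood. *)
Lemma compact_quotient_continuous (T U V : topologicalType) (A : set T)
    (q : T -> V) (h : T -> U) (F : V -> U) :
  hausdorff_space V -> compact A -> closed A ->
  {within A, continuous q} -> {within A, continuous h} ->
  (forall a, A a -> F (q a) = h a) -> {within q @` A, continuous F}.
Proof.
move=> hV cA clA cq ch Fq; apply/within_continuousP => x qAx O.
rewrite nbhsE => -[P [oP PFx] PO].
pose C := A `&` [set a | ~ P (h a)].
have clC : closed C.
  move=> a aC; have Aa : A a by apply: clA; apply: closure_subset aC => ? [].
  split=> //= Pha.
  move/within_continuousP : ch => /(_ a Aa P).
  have : nbhs (h a) P by apply: open_nbhs_nbhs.
  by move=> hP /(_ hP)/aC[b [[Ab nOb] /(_ Ab)]].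
have cC : compact C by apply: subclosed_compact cA _ => // a [].
have clqC : closed (q @` C).
  apply: compact_closed => //; apply: continuous_compact => //.
  by apply: within_continuousW cq => a [].
have : nbhs x (~` (q @` C)).
  apply: open_nbhs_nbhs; split; first exact: closed_openC.
  by move=> [a [Aa nOa] qax]; apply: nOa; rewrite -Fq// qax.
apply: filterS => z nz [a Aa qaz]; apply: PO; rewrite -qaz Fq//.
by apply: contrapT => nO; apply: nz; exists a.
Qed.

Lemma within_comp (T U V : topologicalType) (A : set T) (B : set U)
    (f : T -> U) (g : U -> V) :
  {within A, continuous f} -> {within B, continuous g} ->
  (forall x, A x -> B (f x)) -> {within A, continuous (fun x => g (f x))}.
Proof.
move=> /within_continuousP fA /within_continuousP gB AB.
apply/within_continuousP => x Ax O /(gB _ (AB _ Ax))/(fA x Ax).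
by apply: filterS => z zO Az; apply: zO => //; exact: AB.
Qed.

Lemma within_pair (T U V : topologicalType) (A : set T)
    (f : T -> U) (g : T -> V) :
  {within A, continuous f} -> {within A, continuous g} ->
  {within A, continuous (fun x => (f x, g x))}.
Proof.
move=> /within_continuousP fA /within_continuousP gA.
apply/within_continuousP => x Ax O [[P Q] /= [/(fA x Ax) fP /(gA x Ax) gQ] PQO].
apply: filterS (filterI fP gQ) => z [zP zQ] Az.
by apply: PQO; split=> /=; [exact: zP|exact: zQ].
Qed.

(** Stated for an abstract hereditary predicate [good], which stands for lying in one member of an
    open cover; it serves both for stars in the nerve and for small loops in [M]. *)
Lemma lebesgue_number (R : realType) (T : pseudoMetricType R) (A : set T)
    (good : set T -> Prop) :
  compact A -> (forall B C, B `<=` C -> good C -> good B) ->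
  (forall x, A x -> exists2 e : R, 0 < e & good (ball x e)) ->
  exists2 e : R, 0 < e & forall x, A x -> good (ball x e).
Proof.
move=> /compact_near_coveringP cA mono loc.
have : \forall e \near (0:R)^'+, A `<=` [set x | good (ball x e)].
  apply: cA => x /loc[e e0 ge].
  exists (ball x (e / 2), [set d | d < e / 2]) => /=.
    split; first by apply: nbhsx_ballx; rewrite divr_gt0.
    by apply: nbhs_right_lt; rewrite divr_gt0.
  move=> [y d] /= [xy de]; apply: mono ge => z yz.
  rewrite (splitr e); apply: ball_triangle xy _.
  by apply: le_ball yz; exact: ltW.
move=> /filterI/(_ (nbhs_right_gt 0)) H.
by have [e [eA e0]] := filter_ex H; exists e.
Qed.

Section WithinAlgebra.
Variables (R : realType) (T : topologicalType) (A : set T).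

Lemma within_id : {within A, continuous (fun x : T => x)}.
Proof. by apply: continuous_subspaceT => x; exact: cvg_id. Qed.

Lemma within_cst (U : topologicalType) (u : U) :
  {within A, continuous (fun _ : T => u)}.
Proof. by apply: continuous_subspaceT => x; exact: cvg_cst. Qed.

Lemma withinD (V : normedModType R) (f g : T -> V) :
  {within A, continuous f} -> {within A, continuous g} ->
  {within A, continuous (fun x => f x + g x)}.
Proof.
move=> /subspace_continuousP cf /subspace_continuousP cg.
by apply/subspace_continuousP => x Ax; apply: cvgD; [exact: cf|exact: cg].
Qed.

Lemma withinB (V : normedModType R) (f g : T -> V) :
  {within A, continuous f} -> {within A, continuous g} ->
  {within A, continuous (fun x => f x - g x)}.
Proof.
move=> /subspace_continuousP cf /subspace_continuousP cg.
by apply/subspace_continuousP => x Ax; apply: cvgB; [exact: cf|exact: cg].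
Qed.

Lemma withinZ (V : normedModType R) (k : T -> R) (f : T -> V) :
  {within A, continuous k} -> {within A, continuous f} ->
  {within A, continuous (fun x => k x *: f x)}.
Proof.
move=> /subspace_continuousP ck /subspace_continuousP cf.
by apply/subspace_continuousP => x Ax; apply: cvgZ; [exact: ck|exact: cf].
Qed.

Lemma withinM (f g : T -> R) :
  {within A, continuous f} -> {within A, continuous g} ->
  {within A, continuous (fun x => f x * g x)}.
Proof.
move=> /subspace_continuousP cf /subspace_continuousP cg.
by apply/subspace_continuousP => x Ax; apply: cvgM; [exact: cf|exact: cg].
Qed.

Lemma withinV (f : T -> R) : (forall x, A x -> f x != 0) ->
  {within A, continuous f} -> {within A, continuous (fun x => (f x)^-1)}.
Proof.
move=> f0 /subspace_continuousP cf.
by apply/subspace_continuousP => x Ax; apply: cvgV; [exact: f0|exact: cf].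
Qed.

Lemma within_sum (V : normedModType R) (I : Type) (s : seq I) (f : I -> T -> V) :
  (forall i, {within A, continuous f i}) ->
  {within A, continuous (fun x => \sum_(i <- s) f i x)}.
Proof.
move=> cf; elim: s => [|i s IH].
  by apply: (@eq_within_continuous _ _ _ (fun=> 0)) (@within_cst V 0) => x _; rewrite big_nil.
by apply: eq_within_continuous (withinD (cf i) IH) => x _; rewrite big_cons.
Qed.
End WithinAlgebra.

Lemma within_fst (T U : topologicalType) (A : set (T * U)) :
  {within A, continuous fst}.
Proof. by apply: continuous_subspaceT => x; exact: cvg_fst. Qed.

Lemma within_snd (T U : topologicalType) (A : set (T * U)) :
  {within A, continuous snd}.
Proof. by apply: continuous_subspaceT => x; exact: cvg_snd. Qed.

(** * Filling the square *)

Section Square.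
Variable R : realType.
Implicit Types (t s : R) (z : R * R).

Let clamp t : R := Num.min 1 (Num.max 0 t).

(* Traverses the boundary of the unit square counterclockwise from (0, 0), one
   side per quarter of the parameter interval. *)
Definition perimeter t : R * R :=
  (clamp (4 * t) - clamp (4 * t - 2), clamp (4 * t - 1) - clamp (4 * t - 3)).

Definition square_boundary : set (R * R) :=
  [set z | sq01 z /\ (z.1 = 0 \/ z.1 = 1 \/ z.2 = 0 \/ z.2 = 1)].

Let clampE t : clamp t = if t <= 0 then 0 else if t <= 1 then t else 1.
Proof.
rewrite /clamp minEle maxEle; repeat case: ifPn; lra.
Qed.

Let clamp_continuous : continuous clamp.
Proof.
move=> t; apply: continuous_min; first exact: cvg_cst.
by apply: continuous_max; [exact: cvg_cst|exact: cvg_id].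
Qed.

Lemma perimeterP t : I01 t ->
  [\/ t <= 4^-1 /\ perimeter t = (4 * t, 0),
      4^-1 <= t <= 2^-1 /\ perimeter t = (1, 4 * t - 1),
      2^-1 <= t <= 3 * 4^-1 /\ perimeter t = (3 - 4 * t, 1) |
      3 * 4^-1 <= t /\ perimeter t = (0, 4 - 4 * t)].
Proof.
move=> /andP[t0 t1]; rewrite /perimeter !clampE.
have [h1|h1] := lerP t 4^-1; [apply: Or41|have [h2|h2] := lerP t 2^-1; 
  [apply: Or42|have [h3|h3] := lerP t (3 * 4^-1); [apply: Or43|apply: Or44]]];
  (split; first by lra); congr pair; repeat case: ifPn; lra.
Qed.

Lemma perimeter_boundary t : I01 t -> square_boundary (perimeter t).
Proof.
move=> t01; case: (perimeterP t01) => -[h ->]; move: t01 => /andP[t0 t1];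
  rewrite /square_boundary/sq01/I01/=; split; lra.
Qed.

Lemma perimeter_surj z : square_boundary z -> exists2 t, I01 t & perimeter t = z.
Proof.
case: z => x y [[/andP[/= x0 x1] /andP[/= y0 y1]] b].
case: b => [->|[->|[->|->]]].
- have t01 : I01 (1 - y / 4) by apply/andP; split; lra.
  by exists (1 - y / 4) => //; case: (perimeterP t01) => -[h ->]; congr pair; lra.
- have t01 : I01 ((1 + y) / 4) by apply/andP; split; lra.
  by exists ((1 + y) / 4) => //; case: (perimeterP t01) => -[h ->]; congr pair; lra.
- have t01 : I01 (x / 4) by apply/andP; split; lra.
  by exists (x / 4) => //; case: (perimeterP t01) => -[h ->]; congr pair; lra.
- have t01 : I01 ((3 - x) / 4) by apply/andP; split; lra.
  by exists ((3 - x) / 4) => //; case: (perimeterP t01) => -[h ->]; congr pair; lra.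
Qed.

Lemma perimeter_inj t t' : I01 t -> I01 t' -> perimeter t = perimeter t' ->
  t = t' \/ (t = 0 /\ t' = 1) \/ (t = 1 /\ t' = 0).
Proof.
move=> t01 t'01; case: (perimeterP t01) => -[h ->];
  case: (perimeterP t'01) => -[h' ->] e; move: t01 t'01 (congr1 fst e) (congr1 snd e);
  rewrite /I01/= => {e} /andP[t0 t1] /andP[t0' t1'] e1 e2; lra.
Qed.

Lemma perimeter_continuous (A : set R) : {within A, continuous perimeter}.
Proof.
have aff (c : R) : continuous (fun t => clamp (4 * t - c)).
  move=> t; apply: (@continuous_comp _ _ _ (fun t => 4 * t - c) clamp); last exact: clamp_continuous.
  by apply: cvgB; [apply: cvgM; [exact: cvg_cst|exact: cvg_id]|exact: cvg_cst].
have aff0 : continuous (fun t => clamp (4 * t)).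
  by have := aff 0; under eq_fun do rewrite subr0.
by apply: within_pair; apply: withinB; apply: continuous_subspaceT; rewrite //;
  exact: aff.
Qed.

(* A free null-homotopy of the boundary loop factors through this quotient map
   from the cylinder onto the square, which contracts the boundary to the centre. *)
Let cone (w : R * R) : R * R := ((1 - w.1) * ((perimeter w.2).1 - 2^-1) + 2^-1,
  (1 - w.1) * ((perimeter w.2).2 - 2^-1) + 2^-1).

Lemma closed_itvcc (a b : R) : closed [set t : R | a <= t <= b].
Proof.
have -> : [set t : R | a <= t <= b] = `[a, b].
  by apply/seteqP; split => t; rewrite /= in_itv.
exact: interval_closed.
Qed.

Lemma compact_I01 : compact (@I01 R).
Proof.
have -> : @I01 R = `[0, 1] by apply/seteqP; split => t; rewrite /I01/= in_itv.
exact: segment_compact.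
Qed.

Lemma compact_sq01 : compact (@sq01 R).
Proof.
have -> : @sq01 R = I01 (R:=R) `*` I01 (R:=R) by [].
by apply: compact_setX; exact: compact_I01.
Qed.

Lemma hausdorff_plane : hausdorff_space (R * R)%type.
Proof. exact: (@norm_hausdorff R (R * R)%type). Qed.

Lemma closed_sq01 : closed (@sq01 R).
Proof. by apply: compact_closed; [exact: hausdorff_plane|exact: compact_sq01]. Qed.

Let cone_continuous : {within @sq01 R, continuous cone}.
Proof.
have p_cont : {within @sq01 R, continuous (fun w : R * R => perimeter w.2)}.
  apply: (@within_comp _ _ _ _ setT snd perimeter) => //; first exact: within_snd.
  exact: perimeter_continuous.
have s_cont : {within @sq01 R, continuous (fun w : R * R => 1 - w.1)}.
  by apply: withinB; [exact: within_cst|exact: within_fst].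
apply: within_pair; apply: withinD; try exact: within_cst; apply: withinM => //;
  apply: withinB; try exact: within_cst.
- exact: (@within_comp _ _ _ _ setT _ fst p_cont (@within_fst _ _ _)).
- exact: (@within_comp _ _ _ _ setT _ snd p_cont (@within_snd _ _ _)).
Qed.

Let cone_sq01 w : sq01 w -> sq01 (cone w).
Proof.
case: w => s t [/= /andP[s0 s1] t01]; have [h _] := perimeter_boundary t01.
rewrite /cone [(s, t).2]/= [(s, t).1]/=.
move: (perimeter t) h => [x y] [/= /andP[x0 x1] /andP[y0 y1]].
by split; rewrite /I01/=; apply/andP; split; nra.
Qed.

Let cone_surj z : sq01 z -> exists2 w, sq01 w & cone w = z.
Proof.
case: z => x y [/andP[/= x0 x1] /andP[/= y0 y1]].
(* In the cylinder the point sits at height [1 - r]; its angular coordinate is found by projecting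
   radially from the centre to the boundary, which requires [r] nonzero. *)
pose r := 2 * Num.max `|x - 2^-1| `|y - 2^-1|.
have rx : 2 * `|x - 2^-1| <= r by rewrite ler_pM2l// le_max lexx.
have ry : 2 * `|y - 2^-1| <= r by rewrite ler_pM2l// le_max lexx orbT.
have xb : `|x - 2^-1| <= 2^-1 by rewrite ler_norml; lra.
have yb : `|y - 2^-1| <= 2^-1 by rewrite ler_norml; lra.
have r1 : r <= 1.
  have : Num.max `|x - 2^-1| `|y - 2^-1| <= 2^-1 by rewrite ge_max xb yb.
  by rewrite /r; lra.
have [r0|r0] := lerP r 0.
  exists (1, 0); first by split; rewrite /I01/= ; lra.
  have := normr_ge0 (x - 2^-1); have := normr_ge0 (y - 2^-1).
  move=> hy hx; have /eqP : `|x - 2^-1| = 0 by lra.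
  have /eqP : `|y - 2^-1| = 0 by lra.
  rewrite !normr_eq0 !subr_eq0 => /eqP -> /eqP ->.
  by rewrite /cone/=; congr pair; lra.
have r_neq0 : r != 0 by rewrite gt_eqF.
have xr : (x - 2^-1) / r * r = x - 2^-1 by rewrite divfK.
have yr : (y - 2^-1) / r * r = y - 2^-1 by rewrite divfK.
have : square_boundary ((x - 2^-1) / r + 2^-1, (y - 2^-1) / r + 2^-1).
  have bnd u : 2 * `|u - 2^-1| <= r -> I01 ((u - 2^-1) / r + 2^-1).
    move=> ur; have : `|(u - 2^-1) / r| <= 2^-1.
      by rewrite normrM normfV (gtr0_norm r0) ler_pdivrMr//; lra.
    by rewrite ler_norml /I01/=; lra.
  split; first by split; exact: bnd.
  have ext u : r = 2 * `|u - 2^-1| ->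
      (u - 2^-1) / r + 2^-1 = 0 \/ (u - 2^-1) / r + 2^-1 = 1.
    move=> ru; have : `|(u - 2^-1) / r| = 2^-1.
      rewrite normrM normfV (gtr0_norm r0).
      have u0 : `|u - 2^-1| != 0 by apply: contra_neq r_neq0; rewrite ru => ->; lra.
      by rewrite ru invfM mulrCA divff ?mulr1.
    by case: ger0P => _ e; [right|left]; lra.
  have : r = 2 * `|x - 2^-1| \/ r = 2 * `|y - 2^-1|.
    by rewrite /r maxEle; case: ifPn; [right|left].
  by case=> /ext[]; intuition.
move=> /perimeter_surj[t t01 pt].
exists (1 - r, t); first by split=> //=; rewrite /I01/=; lra.
by rewrite /cone [(1 - r, t).2]/= pt/= subKr !addrK ![r * _]mulrC xr yr !subrK.
Qed.

(** The distance from [cone w] to the centre in the maximum norm is half of [1 - w.1], which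
    recovers the height; away from height 1 one can divide by it and recover the boundary point. *)
Let cone_fiber w w' : sq01 w -> sq01 w' -> cone w = cone w' ->
  w.1 = w'.1 /\ (w.1 = 1 \/ perimeter w.2 = perimeter w'.2).
Proof.
case: w w' => [s t] [s' t'] [/= s01 t01] [/= s'01 t'01] e.
have e1 : (1 - s) * ((perimeter t).1 - 2^-1) + 2^-1 =
  (1 - s') * ((perimeter t').1 - 2^-1) + 2^-1 := congr1 fst e.
have e2 : (1 - s) * ((perimeter t).2 - 2^-1) + 2^-1 =
  (1 - s') * ((perimeter t').2 - 2^-1) + 2^-1 := congr1 snd e.
move: e1 e2 => {e}.
have bnorm u : I01 u ->
    Num.max `|(perimeter u).1 - 2^-1| `|(perimeter u).2 - 2^-1| = 2^-1.
  move=> u01; have [h hb] := perimeter_boundary u01.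
  move: h hb; case: (perimeter u) => x y [/= /andP[x0 x1] /andP[y0 y1]] b.
  have xb : `|x - 2^-1| <= 2^-1 by rewrite ler_norml; lra.
  have yb : `|y - 2^-1| <= 2^-1 by rewrite ler_norml; lra.
  apply/eqP; rewrite eq_le ge_max xb yb/= le_max.
  by case: b => [->|[->|[->|->]]]; rewrite !ler_normr; apply/orP;
    [left|left|right|right]; apply/orP; lra.
move=> /addIr e1 /addIr e2.
move: s01 s'01 => /andP[s0 s1] /andP[s0' s1'].
have ss' : 1 - s = 1 - s'.
  have q1 : 0 <= 1 - s by lra.
  have q2 : 0 <= 1 - s' by lra.
  have := maxr_pMr `|(perimeter t).1 - 2^-1| `|(perimeter t).2 - 2^-1| q1.
  have := maxr_pMr `|(perimeter t').1 - 2^-1| `|(perimeter t').2 - 2^-1| q2.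
  rewrite !bnorm// -{2 3}(ger0_norm q1) -{2 3}(ger0_norm q2) -!normrM e1 e2 => <-; lra.
split; first by lra.
have [->|s_neq1] := eqVneq s 1; [by left|right].
have q0 : 1 - s' != 0 by rewrite -ss' subr_eq0 eq_sym.
move: e1 e2; rewrite ss' => /(mulfI q0)/addIr e1 /(mulfI q0)/addIr e2.
by rewrite (surjective_pairing (perimeter t)) e1 e2 -surjective_pairing.
Qed.

(** Two sets appear because the loop is controlled in a small [Y] while its contraction may wander
    through all of [X]. The free null-homotopy takes equal values on the fibres of [cone], so it
    descends to the square. *)
Lemma fill_square (T : topologicalType) (X Y : set T) (f : R * R -> T) :
  (forall g : R -> T, loop_in Y g -> contractible_in X g) ->
  {within square_boundary, continuous f} -> f @` square_boundary `<=` Y ->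
  exists F : R * R -> T, {within @sq01 R, continuous F} /\
    F @` @sq01 R `<=` X /\ (forall z, square_boundary z -> F z = f z).
Proof.
move=> YX cf fY.
have [] := YX (f \o perimeter).
  split; first apply: (@within_comp _ _ _ _ square_boundary) => //.
  - exact: perimeter_continuous.
  - exact: perimeter_boundary.
  split.
    rewrite /=; congr f; have [h0 h1] : I01 (0 : R) /\ I01 (1 : R) by split; apply/andP.
    by case: (perimeterP h0) => -[h ->]; case: (perimeterP h1) => -[h' ->]; congr pair; lra.
  by move=> _ [t t01 <-]; apply: fY; exists (perimeter t) => //; exact: perimeter_boundary.
move=> H [cH [HX [Hg Hs]]].
have /choice[F FH] : forall z, exists u, forall w, sq01 w -> cone w = z -> u = H w.
  move=> z; have [/cone_surj[w sw wz]|nz] := pselect (sq01 z); last first.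
    by exists (H (0, 0)) => w /cone_sq01 sw wz; exfalso; apply: nz; rewrite -wz.
  exists (H w) => w' sw' w'z; rewrite -w'z in wz.
  have [e1 []] := cone_fiber sw sw' wz.
    case: w w' sw sw' e1 {wz w'z} => [s t] [s' t'] /= [_ /= t01] [_ /= t'01] <- ->.
    by rewrite (Hg t t01).2 (Hg t' t'01).2.
  case: w w' sw sw' e1 {wz w'z} => [s t] [s' t'] [/= s01 t01] [_ /= t'01] <-.
  move=> /(perimeter_inj t01 t'01)[->//|[[-> ->]|[-> ->]]]; first exact: Hs.
  by rewrite Hs.
have FX z : sq01 z -> exists2 w, sq01 w & F z = H w.
  by move=> /cone_surj[w sw wz]; exists w => //; exact: FH.
exists F; split; last split.
- have -> : @sq01 R = cone @` @sq01 R.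
    apply/seteqP; split=> [z /cone_surj[w sw <-]|_ [w sw <-]]; first by exists w.
    exact: cone_sq01.
  apply: (compact_quotient_continuous _ compact_sq01 closed_sq01 cone_continuous cH).
    exact: hausdorff_plane.
  by move=> w sw; rewrite (FH _ w).
- by move=> _ [z /FX[w sw ->] <-]; apply: HX; exists w.
- move=> z /perimeter_surj[t t01 tz].
  rewrite (FH z (0, t)); [by rewrite (Hg t t01).1 /= tz| |].
    by split=> //; rewrite /I01/= lexx ler01.
  by rewrite /cone [(0, t).2]/= tz; case: z {tz} => x y /=; congr pair; lra.
Qed.
End Square.

(** * Grids and paths *)

Section Grid.
Variable R : realType.
Implicit Types (t s x : R) (z : R * R) (a b : nat).

Definition cell a b : set (R * R) :=
  [set z | a%:R <= z.1 <= a.+1%:R /\ b%:R <= z.2 <= b.+1%:R].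

Definition cell_boundary a b : set (R * R) := [set z | cell a b z /\
  (z.1 = a%:R \/ z.1 = a.+1%:R \/ z.2 = b%:R \/ z.2 = b.+1%:R)].

Definition grid (A B : nat) : set (R * R) :=
  [set z | 0 <= z.1 <= A%:R /\ 0 <= z.2 <= B%:R].

Lemma nat_interval (A : nat) x : (0 < A)%N -> 0 <= x <= A%:R ->
  exists2 a : 'I_A, true & a%:R <= x <= a.+1%:R.
Proof.
elim: A => // A IH _ /andP[x0 xA].
have [Ax|xA'] := lerP A%:R x; first by exists ord_max => //; apply/andP.
case: A IH xA xA' => [|A] IH xA xA'; first by have := lt_le_trans xA' x0; rewrite ltxx.
have [//||a _ xa] := IH; first by rewrite x0 ltW.
by exists (widen_ord (leqnSn _) a).
Qed.

Lemma nat_interval_overlap a a' x : a != a' ->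
  a%:R <= x <= a.+1%:R -> a'%:R <= x <= a'.+1%:R ->
  (x = a%:R \/ x = a.+1%:R) /\ (x = a'%:R \/ x = a'.+1%:R).
Proof.
move=> aa' /andP[ax xa] /andP[a'x xa'].
have [lt|lt] : (a.+1 <= a')%N \/ (a'.+1 <= a)%N.
  by move: aa'; rewrite neq_ltn => /orP.
- move: lt; rewrite -(ler_nat R) => lt.
  by split; [right|left]; apply/eqP; rewrite eq_le ?ax ?xa ?a'x ?(le_trans xa lt) ?(le_trans lt a'x).
- move: lt; rewrite -(ler_nat R) => lt.
  by split; [left|right]; apply/eqP; rewrite eq_le ?a'x ?xa' ?ax ?(le_trans xa' lt) ?(le_trans lt ax).
Qed.

Lemma closed_cell a b : closed (cell a b).
Proof.
have -> : cell a b = (fst @^-1` [set t : R | a%:R <= t <= a.+1%:R]) `&`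
    (snd @^-1` [set t : R | b%:R <= t <= b.+1%:R]) by [].
by apply: closedI; apply: (@closed_comp (R * R)%type R); first [exact: closed_itvcc|
  move=> z _; exact: cvg_fst|move=> z _; exact: cvg_snd].
Qed.

Lemma fill_cell (T : topologicalType) (X Y : set T) (f : R * R -> T) a b :
  (forall g : R -> T, loop_in Y g -> contractible_in X g) ->
  {within cell_boundary a b, continuous f} -> f @` cell_boundary a b `<=` Y ->
  exists F : R * R -> T, {within cell a b, continuous F} /\
    F @` cell a b `<=` X /\ (forall z, cell_boundary a b z -> F z = f z).
Proof.
move=> YX cf fY.
have bd z : square_boundary z -> cell_boundary a b (z.1 + a%:R, z.2 + b%:R).
  move=> [[/andP[x0 x1] /andP[y0 y1]] h]; split; first by split=> /=; lra.
  rewrite /= -!natr1.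
  by case: h => [->|[->|[->|->]]]; rewrite ?add0r -?[1 + _]addrC; tauto.
have cbd z : cell a b z -> sq01 (z.1 - a%:R, z.2 - b%:R).
  by move=> [/andP[x0 x1] /andP[y0 y1]]; split; rewrite /I01/=; lra.
have [F [cF [FX Ff]]] : exists F : R * R -> T, {within @sq01 R, continuous F} /\
    F @` @sq01 R `<=` X /\
    (forall z, square_boundary z -> F z = f (z.1 + a%:R, z.2 + b%:R)).
  apply: fill_square YX _ _.
    apply: (@within_comp _ _ _ _ (cell_boundary a b)) => //.
    by apply: within_pair; apply: withinD; try exact: within_cst;
      [exact: within_fst|exact: within_snd].
  by move=> _ [z /bd zb <-]; apply: fY; exists (z.1 + a%:R, z.2 + b%:R).
exists (fun z => F (z.1 - a%:R, z.2 - b%:R)); split; last split.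
- apply: within_comp cF cbd.
  by apply: within_pair; apply: withinB; try exact: within_cst;
      [exact: within_fst|exact: within_snd].
- by move=> _ [z /cbd zc <-]; apply: FX; exists (z.1 - a%:R, z.2 - b%:R).
- move=> z [zc h]; rewrite Ff/=; first by rewrite !subrK -surjective_pairing.
  split; first exact: cbd.
  rewrite /=; case: h => [->|[->|[->|->]]]; rewrite -?natr1; lra.
Qed.

(** Distinct cells meet only in points of both boundaries, where both fillings equal [f]; hence the
    fillings glue. Each cell may use its own set [Y a b]. *)
Lemma fill_grid (T : topologicalType) (X : set T) (Y : nat -> nat -> set T)
    (f : R * R -> T) (A B : nat) : (0 < A)%N -> (0 < B)%N ->
  (forall a b, (a < A)%N -> (b < B)%N ->
    [/\ forall g : R -> T, loop_in (Y a b) g -> contractible_in X g,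
        {within cell_boundary a b, continuous f} &
        f @` cell_boundary a b `<=` Y a b]) ->
  exists F : R * R -> T, {within grid A B, continuous F} /\
    F @` grid A B `<=` X /\
    forall a b z, (a < A)%N -> (b < B)%N -> cell_boundary a b z -> F z = f z.
Proof.
move=> A0 B0 H.
have /choice[F FH] : forall i : 'I_A * 'I_B, exists F : R * R -> T,
    {within cell i.1 i.2, continuous F} /\
    F @` cell i.1 i.2 `<=` X /\ (forall z, cell_boundary i.1 i.2 z -> F z = f z).
  by move=> [a b] /=; have [h1 h2 h3] := H a b (ltn_ord a) (ltn_ord b);
    exact: fill_cell h1 h2 h3.
have gridE : grid A B = \bigcup_(i : 'I_A * 'I_B) cell i.1 i.2.
  apply/seteqP; split=> z.
    move=> [/(nat_interval A0)[a _ za] /(nat_interval B0)[b _ zb]].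
    by exists (a, b).
  move=> [[a b] _ [/= /andP[x0 x1] /andP[y0 y1]]]; split; apply/andP; split.
  - exact: le_trans x0.
  - by apply: le_trans x1 _; rewrite ler_nat.
  - exact: le_trans y0.
  - by apply: le_trans y1 _; rewrite ler_nat.
have [|||G [cG GF]] := @glue_closed _ _ _ (fun i : 'I_A * 'I_B => cell i.1 i.2) F f.
- by move=> i; exact: closed_cell.
- by move=> i; have [] := FH i.
- move=> i j z zi zj; have [->//|ij] := eqVneq i j.
  have [_ [_ Fi]] := FH i; have [_ [_ Fj]] := FH j.
  have [ne|ne] : (i.1 != j.1 :> nat) \/ (i.2 != j.2 :> nat).
    case: i j ij {zi zj Fi Fj} => [i i'] [j j'] /=.
    by rewrite xpair_eqE negb_and => /orP.
  + have [h1 h2] := nat_interval_overlap ne zi.1 zj.1.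
    by rewrite Fi ?Fj//; split=> //; tauto.
  + have [h1 h2] := nat_interval_overlap ne zi.2 zj.2.
    by rewrite Fi ?Fj//; split=> //; tauto.
exists G; rewrite gridE; split=> //; split.
  move=> _ [z [i _ zi] <-]; rewrite (GF i)//.
  by have [_ [FX _]] := FH i; apply: FX; exists z.
move=> a b z aA bB zb; rewrite (GF (Ordinal aA, Ordinal bB)); last exact: zb.1.
by have [_ [_ ->]] := FH (Ordinal aA, Ordinal bB).
Qed.

Section Paths.
Variable T : topologicalType.
Implicit Types (V : set T) (u v : T).

Definition joined V u v := exists p : R -> T,
  {within @I01 R, continuous p} /\ p 0 = u /\ p 1 = v /\ p @` @I01 R `<=` V.

(** Each step takes one unit of parameter, so that breakpoints are integers and line up with the
    cells of a grid; rescaling to the unit interval is left to the users. *)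
Lemma chain_path (B : nat) (m : nat -> T) (V : nat -> set T) : (0 < B)%N ->
  (forall b, (b < B)%N -> joined (V b) (m b) (m b.+1)) ->
  exists w : R -> T, {within [set t : R | 0 <= t <= B%:R], continuous w} /\
    (forall b, (b <= B)%N -> w b%:R = m b) /\
    (forall b t, (b < B)%N -> b%:R <= t <= b.+1%:R -> V b (w t)).
Proof.
move=> B0 H.
have /choice[p pH] : forall b : 'I_B, exists p : R -> T,
    {within @I01 R, continuous p} /\ p 0 = m b /\ p 1 = m b.+1 /\
    p @` @I01 R `<=` V b by move=> b; exact: H.
have shift b t : b%:R <= t <= b.+1%:R -> I01 (t - b%:R).
  by rewrite -natr1 /I01/=; lra.
have [|||w [cw wp]] := @glue_closed _ _ _
  (fun b : 'I_B => [set t : R | b%:R <= t <= b.+1%:R])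
  (fun (b : 'I_B) t => p b (t - b%:R)) (fun=> m 0%N).
- by move=> b; exact: closed_itvcc.
- move=> b; have [cp _] := pH b; apply: within_comp cp _; last exact: shift.
  by apply: withinB; [exact: within_id|exact: within_cst].
(* At an endpoint of its interval a piece takes the value of [m] at that very integer, so two pieces
   sharing an endpoint agree there. *)
- have vals (b : 'I_B) t : t = b%:R \/ t = b.+1%:R ->
      p b (t - b%:R) = m (if t == b%:R then b : nat else b.+1).
    have [_ [p0 [p1 _]]] := pH b.
    case=> ->; first by rewrite eqxx subrr.
    by rewrite eqr_nat gtn_eqF// -natr1 addrAC subrr add0r.
  move=> b b' t tb tb'; have [->//|bb'] := eqVneq b b'.
  have ne : (b : nat) != b' by [].
  have [h h'] := nat_interval_overlap ne tb tb'; rewrite !vals//; congr m.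
  apply/eqP; rewrite -(eqr_nat R); apply/eqP.
  by case: ifPn => [/eqP <-|/eqP n1]; case: ifPn => [/eqP <-//|/eqP n2]; case: h => //; case: h' => // <-.
have wU : \bigcup_(b : 'I_B) [set t : R | b%:R <= t <= b.+1%:R] =
    [set t : R | 0 <= t <= B%:R].
  apply/seteqP; split=> [t [b _ /= /andP[t0 t1]]|t /= /(nat_interval B0)[b _ tb]].
    by rewrite (le_trans _ t0)//= (le_trans t1)// ler_nat.
  by exists b.
exists w; rewrite -wU; split=> //; split=> [b|b t bB tb]; last first.
  rewrite (wp (Ordinal bB))//=; have [_ [_ [_ pV]]] := pH (Ordinal bB).
  by apply: pV; exists (t - b%:R) => //; exact: shift.
rewrite leq_eqVlt => /orP[/eqP ->|bB].
  have B1 : (B.-1 < B)%N by rewrite prednK.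
  rewrite (wp (Ordinal B1)) /= ?prednK//; last by rewrite lexx andbT ler_nat leq_pred.
  have [_ [_ [p1 _]]] := pH (Ordinal B1).
  by rewrite -[X in X%:R - _](prednK B0) -natr1 addrAC subrr add0r p1 /= prednK.
rewrite (wp (Ordinal bB)) /=; last by rewrite lexx ler_nat leqnSn.
by have [_ [p0 _]] := pH (Ordinal bB); rewrite subrr p0.
Qed.

Lemma joined_refl V u : V u -> joined V u u.
Proof.
by exists (fun=> u); split; [exact: within_cst|do 2!split=> //; move=> _ [t _ <-]].
Qed.

Lemma joined_sym V u v : joined V u v -> joined V v u.
Proof.
move=> [p [cp [p0 [p1 pV]]]]; exists (fun t => p (1 - t)).
have I1 t : I01 t -> I01 (1 - t) by rewrite /I01/=; lra.
split; first by apply: within_comp cp I1; apply: withinB; [exact: within_cst|exact: within_id].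
rewrite subr0 subrr; do 2!split=> //.
by move=> _ [t t01 <-]; apply: pV; exists (1 - t) => //; exact: I1.
Qed.

Lemma joined_trans V u v w : joined V u v -> joined V v w -> joined V u w.
Proof.
move=> uv vw.
have [//||p [cp [pm pV]]] := @chain_path 2 (nth u [:: u; v; w]) (fun=> V).
  by case=> [|[|]].
have I2 t : I01 t -> 0 <= 2 * t <= 2 by rewrite /I01/=; lra.
exists (fun t => p (2 * t)); split.
  apply: within_comp cp I2.
  by apply: withinM; [exact: within_cst|exact: within_id].
rewrite mulr0 mulr1 (pm 0%N)// (pm 2%N)//; do 2!split=> //.
move=> _ [t /I2 t01 <-].
by have [//|b _ tb] := @nat_interval 2 _ _ t01; apply: (pV b).
Qed.

Lemma joined_in V u v : joined V u v -> V u /\ V v.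
Proof.
move=> [p [_ [<- [<- pV]]]].
by split; apply: pV; [exists 0|exists 1] => //; rewrite /I01/= ?lexx ?ler01.
Qed.

Lemma joined_mono V V' u v : V `<=` V' -> joined V u v -> joined V' u v.
Proof. by move=> VV' [p [? [? [? pV]]]]; exists p; do 3!split=> //; exact: subset_trans VV'. Qed.

(* All points of a path are joined to its origin, so path components are path
   connected within themselves. *)
Lemma joined_component V u v : joined V u v -> joined (joined V u) u v.
Proof.
move=> [p [cp [p0 [p1 pV]]]]; exists p; do 3!split=> //.
move=> _ [s /andP[s0 s1] <-]; exists (fun t => p (s * t)).
have I1 t : I01 t -> I01 (s * t) by rewrite /I01/= => /andP[t0 t1]; apply/andP; split; nra.
split; first by apply: within_comp cp I1; apply: withinM; [exact: within_cst|exact: within_id].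
rewrite mulr0 mulr1; do 2!split=> //.
by move=> _ [t t01 <-]; apply: pV; exists (s * t) => //; exact: I1.
Qed.
End Paths.
End Grid.

(** * The nerve of a cover *)

Section NerveMap.
Variables (R : realType) (T : pseudoMetricType R) (M : set T).
Variables (r : nat) (V : 'I_r -> set T).
Hypothesis V_open : forall j x, V j x -> nbhs x [set z | M z -> V j z].
Hypothesis V_cover : forall x, M x -> exists j, V j x.

(** The guard [0 < e] keeps 0 in the set even when [x] is outside [V j], and the bound 1 matters
    when [V j] is all of [M]; the supremum is therefore always a genuine one. *)
Let radii j x : set R :=
  [set e | 0 <= e <= 1 /\ (0 < e -> forall z, M z -> ball x e z -> V j z)].

(* The radius, capped at 1, of the largest ball around [x] whose trace on [M]
   stays in [V j]. *)
Let depth j x : R := sup (radii j x).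

Let radii_has_sup j x : has_sup (radii j x).
Proof.
split; last by exists 1 => e [/andP[]].
exists 0; split; first by rewrite lexx ler01.
by rewrite ltxx.
Qed.

Let depth_ge0 j x : 0 <= depth j x.
Proof.
apply: sup_upper_bound; first exact: radii_has_sup.
split; first by rewrite lexx ler01.
by rewrite ltxx.
Qed.

Let depth_gt0 j x : V j x -> 0 < depth j x.
Proof.
move=> /V_open/nbhs_ballP[e /= e0 xe].
have h0 : 0 < Num.min 1 e by rewrite lt_min ltr01.
apply: (lt_le_trans h0); apply: sup_upper_bound; first exact: radii_has_sup.
split; first by apply/andP; split; [exact: ltW|rewrite ge_min lexx].
move=> _ z Mz xz; apply: xe => //; apply: le_ball xz.
by rewrite ge_min lexx orbT.
Qed.

Let depth_in j x : M x -> 0 < depth j x -> V j x.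
Proof.
move=> Mx d0; have := sup_adherent d0 (radii_has_sup j x); rewrite subrr.
by move=> [e [_ eV]] e0; apply: eV => //; exact: ballxx.
Qed.

(** If [y] is within [d] of [x], the ball of radius [e - d] around [y] lies in the ball of radius
    [e] around [x]. This Lipschitz bound is the source of continuity. *)
Let depth_lip j x y d : 0 < d -> ball x d y -> depth j x <= depth j y + d.
Proof.
move=> d0 xy; apply: ge_sup; first by have [] := radii_has_sup j x.
move=> e [/andP[e0 e1] eV]; rewrite -lerBlDr.
have [ed|ed] := lerP e d; first by apply: le_trans (depth_ge0 j y); lra.
apply: sup_upper_bound; first exact: radii_has_sup.
split; first by apply/andP; split; lra.
move=> _ z Mz yz; apply: eV => //; first exact: lt_trans ed; have -> : e = d + (e - d) by lra.
exact: ball_triangle xy yz.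
Qed.

Let depth_continuous j : continuous (depth j).
Proof.
move=> x; apply/cvgrPdist_lt => e e0.
have e20 : 0 < e / 2 by rewrite divr_gt0.
apply: filterS (nbhsx_ballx x (e / 2) e20) => y xy.
have := depth_lip j e20 xy; have := depth_lip j e20 (ball_sym xy).
by rewrite ltr_norml; lra.
Qed.

Let total x := \sum_j depth j x.

Let total_gt0 x : M x -> 0 < total x.
Proof.
move=> /V_cover[j /depth_gt0 j0]; rewrite /total (bigD1 j)//=.
by apply: ltr_pwDl => //; apply: sumr_ge0.
Qed.

(** The canonical map to the nerve, given by the partition of unity obtained from normalising the
    depths. *)
Definition nerve_map x : 'rV[R]_r := \sum_j (depth j x / total x) *: delta_mx 0 j.

Let nerve_mapE x j : nerve_map x 0 j = depth j x / total x.
Proof.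
rewrite /nerve_map summxE (bigD1 j)//= !mxE !eqxx mulr1 big1 ?addr0// => i ij.
by rewrite !mxE eqxx (negbTE (_ : j != i)) ?mulr0// eq_sym.
Qed.

(** The geometric realisation of the nerve in barycentric coordinates: the sets indexed by the
    support of a point must share a point of [M]. This form needs no reference to simplices, and the
    common point [x] is what lifts a point of the nerve back to [M]. *)
Definition nerve : set 'rV[R]_r := [set y | (forall j, 0 <= y 0 j) /\
  \sum_j y 0 j = 1 /\ exists x, M x /\ forall j, 0 < y 0 j -> V j x].

(** The support of the image is exactly the set of indices whose sets contain [x]. One direction
    places lifted points in [V j], the other puts [x] in the sets of any star containing its
    image. *)
Lemma nerve_map_gt0 x j : M x -> (0 < nerve_map x 0 j) <-> V j x.
Proof.
move=> Mx; have t0 := total_gt0 Mx; rewrite nerve_mapE; split.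
  by rewrite pmulr_lgt0 ?invr_gt0// => /(depth_in Mx).
by move=> /depth_gt0 d0; rewrite divr_gt0.
Qed.

Lemma nerve_map_in x : M x -> nerve (nerve_map x).
Proof.
move=> Mx; have t0 := total_gt0 Mx; split.
  by move=> j; rewrite nerve_mapE divr_ge0// ltW.
split.
  under eq_bigr do rewrite nerve_mapE.
  by rewrite -mulr_suml divff// gt_eqF.
by exists x; split=> // j /nerve_map_gt0; apply.
Qed.

Lemma nerve_map_continuous : {within M, continuous nerve_map}.
Proof.
have c j : {within M, continuous (depth j)}.
  by apply: continuous_subspaceT; exact: depth_continuous.
apply: within_sum => j; apply: withinZ; last exact: within_cst.
apply: withinM => //; apply: withinV => [x /total_gt0/gt_eqF -> //|].
exact: within_sum.
Qed.
End NerveMap.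

(** * The fundamental group of the nerve *)

Lemma I01_0 (R : realType) : I01 (0 : R). Proof. by rewrite /I01/= lexx ler01. Qed.

Lemma I01_div (R : realType) (B : nat) (t : R) :
  (0 < B)%N -> 0 <= t <= B%:R -> I01 (t / B%:R).
Proof.
move=> B0 /andP[t0 tB]; have B0' : (0 : R) < B%:R by rewrite ltr0n.
by rewrite /I01/= divr_ge0// ler_pdivrMr// mul1r.
Qed.

Lemma I01_mul (R : realType) (B : nat) (t : R) : I01 t -> 0 <= B%:R * t <= B%:R.
Proof.
move=> /andP[t0 t1]; rewrite mulr_ge0//=.
by rewrite -[leRHS]mulr1 ler_wpM2l.
Qed.

Section NerveIso.
Variables (R : realType) (T : pseudoMetricType R) (M : set T).
Variables (r : nat) (V : 'I_r -> set T).
Hypothesis V_sub : forall j, V j `<=` M.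
Hypothesis V_open : forall j x, V j x -> nbhs x [set z | M z -> V j z].
Hypothesis V_cover : forall x, M x -> exists j, V j x.
Hypothesis V_joined : forall j x y, V j x -> V j y -> joined R (V j) x y.

Let psi := nerve_map M V.
Let K := nerve M V.
Implicit Types (j : 'I_r) (y : 'rV[R]_r).

Let K_coord y : K y -> exists j, 0 < y 0 j.
Proof.
move=> [y0 [y1 _]]; apply: contrapT => /forallNP H.
have /eqP := y1; rewrite big1 ?(eq_sym 0) ?oner_eq0// => j _.
by apply/eqP; rewrite eq_le y0 andbT leNgt; apply/negP; exact: H.
Qed.

Let coord_within (A : set (R * R)) (H : R * R -> 'rV[R]_r) j :
  {within A, continuous H} -> {within A, continuous (fun z => H z 0 j)}.
Proof.
move=> cH.
apply: (@within_comp _ _ _ A setT H (fun y : 'rV[R]_r => y 0 j)) => //.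
by apply: continuous_subspaceT; exact: coord_continuous.
Qed.

(** The open stars, where one coordinate is positive, cover the nerve, so their preimages have a
    Lebesgue number on the square. *)
Lemma star_subdivision (H : R * R -> 'rV[R]_r) :
  {within @sq01 R, continuous H} -> H @` @sq01 R `<=` K ->
  exists2 B : nat, (0 < B)%N & forall a b, (a < B)%N -> (b < B)%N ->
    exists j, forall z, cell a b z -> 0 < H (z.1 / B%:R, z.2 / B%:R) 0 j.
Proof.
move=> cH HK.
have [|||e e0 He] := @lebesgue_number R _ (@sq01 R)
  (fun C => exists j, forall z, C z -> sq01 z -> 0 < H z 0 j).
- exact: compact_sq01.
- by move=> C D CD [j jD]; exists j => z /CD; exact: jD.
- move=> z sz; have [|j j0] := @K_coord (H z); first by apply: HK; exists z.
  have /within_continuousP/(_ z sz [set x | 0 < x]) := @coord_within _ _ j cH.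
  case/(_ _)/nbhs_ballP; first by apply: lt_nbhsr.
  by move=> e /= e0 eH; exists e => //; exists j.
pose B := (Num.truncn e^-1).+1.
have B0 : (0 : R) < B%:R by rewrite ltr0n.
have Be : B%:R^-1 < e.
  rewrite invf_plt ?posrE//; exact: truncnS_gt.
exists B => // a b aB bB.
(* Balls of the plane are products of intervals, so a cell of side [1 / B < e] lies in the ball of
   radius [e] around its lower corner. *)
have sab : sq01 (a%:R / B%:R : R, b%:R / B%:R : R).
  by split; apply: I01_div => //; rewrite ler0n ler_nat ltnW.
have [j jH] := He _ sab; exists j => z [/andP[x0 x1] /andP[y0 y1]].
have near (c : nat) (x : R) : c%:R <= x -> x <= c.+1%:R -> ball (c%:R / B%:R : R) e (x / B%:R).
  move=> cx xc; rewrite /ball/= -mulrBl normrM normfV (gtr0_norm B0).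
  have cx1 : `|c%:R - x| <= 1.
    by rewrite distrC ger0_norm ?subr_ge0// lerBlDl natr1.
  by apply: le_lt_trans Be; rewrite ler_piMl// invr_ge0 ltW.
apply: jH; first by split=> /=; exact: near.
by split; apply: I01_div => //; apply/andP; split;
  [exact: le_trans x0|apply: le_trans x1 _; rewrite ler_nat|
   exact: le_trans y0|apply: le_trans y1 _; rewrite ler_nat].
Qed.

(** The straight contraction to the vertex [j] stays in the nerve: it adds no index to the support
    except [j], which is there already, so the same common point of [M] remains a witness. *)
Lemma star_contractible j (g : R -> 'rV[R]_r) :
  loop_in [set y | K y /\ 0 < y 0 j] g -> contractible_in K g.
Proof.
move=> [cg [g01 gK]]; exists (fun z => (1 - z.1) *: g z.2 + z.1 *: delta_mx 0 j).
have cg' : {within @sq01 R, continuous (fun z => g z.2)}.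
  by apply: within_comp cg _; [exact: within_snd|move=> z []].
split; first apply: withinD.
- apply: withinZ => //; apply: withinB; [exact: within_cst|exact: within_fst].
- apply: withinZ; [exact: within_fst|exact: within_cst].
split; last split.
- move=> _ [[s t] [/= /andP[s0 s1] t01] <-].
  have [|[g0 [g1 [x [Mx xV]]]] gj] := gK (g t); first by exists t.
  split; [|split].
  + move=> i; rewrite !mxE addr_ge0// mulr_ge0// subr_ge0//.
  + under eq_bigr do rewrite !mxE.
    rewrite big_split/= -!mulr_sumr g1 (bigD1 j)//= eqxx big1 ?addr0; last first.
      by move=> i /negbTE ->; rewrite ?andbF.
    by rewrite !mulr1 subrK.
  + exists x; split=> // i; rewrite !mxE /=.
    have [->|ij] := eqVneq i j; first by move=> _; exact: xV.
    rewrite mulr0 addr0 => H; apply: xV; rewrite lt_neqAle g0 andbT eq_sym.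
    by apply: contraTneq H => ->; rewrite mulr0 ltxx.
- by move=> t _ /=; rewrite subr0 scale1r scale0r addr0 subrr !scale0r.
- by move=> s _ /=; rewrite g01.
Qed.

Lemma nerve_map_surj (x0 : T) (k : R -> 'rV[R]_r) : M x0 ->
  based_loop K (psi x0) k ->
  exists g : R -> T, based_loop M x0 g /\ homotopic_rel K (psi x0) k (psi \o g).
Proof.
move=> Mx0 [[ck [k01 kK]] k0].
have psiP := nerve_map_gt0 V_open V_cover.
have [j0 _] := V_cover Mx0.
have ck2 : {within @sq01 R, continuous (fun z => k z.2)}.
  by apply: within_comp ck _; [exact: within_snd|move=> z []].
have [|B B0 HB] := star_subdivision ck2.
  by move=> _ [z [_ zI] <-]; apply: kK; exists z.2.
have B0R : (0 : R) < B%:R by rewrite ltr0n.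
have Bneq0 : (B%:R : R) != 0 by rewrite gt_eqF.
have /choice[j jP] : forall b, exists j, (b < B)%N -> forall t : R,
    b%:R <= t <= b.+1%:R -> 0 < k (t / B%:R) 0 j.
  move=> b; have [bB|Bb] := ltnP b B; last by exists j0.
  have [j jH] := HB 0%N b B0 bB; exists j => _ t tb.
  by apply: (jH (0, t)); split=> //=; rewrite lexx ler01.
(* Lifts of the subdivision points of [k]: a common point of all sets in the support, except at both
   ends, where [x0] itself is taken so that the lifted path closes up at the base point. Each [m b]
   lies in the sets of both adjacent segments. *)
have /choice[m mP] : forall b : nat, exists x, ((b <= B)%N -> M x /\
    forall j, 0 < k (b%:R / B%:R) 0 j -> V j x) /\
    (b = 0%N \/ b = B -> x = x0).
  move=> b; have [bB|bB] := pselect (b = 0%N \/ b = B).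
    exists x0; split=> // _; split=> // i.
    have -> : k (b%:R / B%:R) = psi x0.
      by case: bB => ->; rewrite ?mul0r ?divff// -k01.
    by move/psiP; exact.
  have [bB'|Bb] := leqP b B; last by exists x0; split=> // /bB.
  have [|_ [_ [x [Mx xV]]]] := kK (k (b%:R / B%:R)).
    by exists (b%:R / B%:R) => //; apply: I01_div => //; rewrite ler0n ler_nat.
  by exists x; split.
have Vm b : (b < B)%N -> V (j b) (m b) /\ V (j b) (m b.+1).
  move=> bB; split; [have [/(_ (ltnW bB))[_ h] _] := mP b|have [/(_ bB)[_ h] _] := mP b.+1];
    apply: h; apply: jP => //; by rewrite lexx ler_nat leqnSn.
have [w [cw [wm wV]]] := @chain_path R T B m (fun b => V (j b)) B0
  (fun b bB => V_joined (Vm b bB).1 (Vm b bB).2).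
have wM t : 0 <= t <= B%:R -> M (w t).
  by move=> /(nat_interval B0)[b _ tb]; apply: V_sub; exact: wV tb.
pose g t := w (B%:R * t).
have cg : {within @I01 R, continuous g}.
  by apply: within_comp cw _; [apply: withinM; [exact: within_cst|exact: within_id]|
    move=> t; exact: I01_mul].
have m0 : m 0%N = x0 by apply: (mP 0%N).2; left.
have mB : m B = x0 by apply: (mP B).2; right.
exists g; split.
  split; last by rewrite /g mulr0 (wm 0%N).
  split=> //; split; first by rewrite /g mulr0 mulr1 (wm 0%N)// (wm B)// m0 mB.
  by move=> _ [t tI <-]; apply: wM; exact: I01_mul.
(* This straight homotopy may leave the nerve inside a strip, since the supports of [k] and of the
   lifted path need not share a point of [M] there. At integer times they share [m b], and the sides
   0 and 1 are the two loops themselves. So [f] is trusted only on cell boundaries and replaced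
   inside by contractions in stars. *)
pose f z : 'rV[R]_r := (1 - z.1) *: k (z.2 / B%:R) + z.1 *: psi (w z.2).
have cellB b (z : R * R) : (b < B)%N -> cell 0 b z -> 0 <= z.2 <= B%:R.
  move=> bB [_ /andP[zb bz]]; rewrite (le_trans _ zb)//= (le_trans bz)//.
  by rewrite ler_nat.
have [//|//||F [cF [FK Ff]]] := @fill_grid R _ K
    (fun _ b => [set y | K y /\ 0 < y 0 (j b)]) f 1 B.
  move=> a b; rewrite ltnS leqn0 => /eqP -> bB; split.
  - by move=> h; exact: star_contractible.
  - have cpsi : {within M, continuous psi} := nerve_map_continuous V_open V_cover.
    apply: withinD; apply: withinZ; try exact: within_fst.
    + by apply: withinB; [exact: within_cst|exact: within_fst].
    + apply: within_comp ck _; first by apply: withinM; [exact: within_snd|exact: within_cst].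
      by move=> z [/(cellB _ _ bB) zB _]; exact: I01_div.
    + apply: within_comp cpsi _; last by move=> z [/(cellB _ _ bB) zB _]; exact: wM.
      by apply: within_comp cw _; [exact: within_snd|move=> z [/(cellB _ _ bB)]].
  - move=> _ [[s t] [zc zb] <-]; have tB := cellB _ _ bB zc.
    case: zc zb => /= /andP[s0 s1] tb zb; rewrite /f/=.
    have kj := jP b bB t tb.
    have Mwt := wM _ tB.
    have pj : 0 < psi (w t) 0 (j b) by apply/psiP => //; exact: wV tb.
    have kKt : K (k (t / B%:R)) by apply: kK; exists (t / B%:R) => //; exact: I01_div.
    have pK : K (psi (w t)) := nerve_map_in V_open V_cover Mwt.
    have conv x : M x -> (forall i, 0 < k (t / B%:R) 0 i \/ 0 < psi (w t) 0 i -> V i x) ->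
        K ((1 - s) *: k (t / B%:R) + s *: psi (w t)).
      move=> Mx xV; have [ka [kb _]] := kKt; have [pa [pb _]] := pK.
      split; [|split].
      - by move=> i; rewrite !mxE addr_ge0// mulr_ge0// subr_ge0.
      - under eq_bigr do rewrite !mxE.
        by rewrite big_split/= -!mulr_sumr kb pb !mulr1 subrK.
      - exists x; split=> // i; rewrite !mxE => H; apply: xV.
        rewrite !lt_neqAle ka pa !andbT; apply: contrapT => /not_orP[].
        move=> /negP/negPn/eqP e1 /negP/negPn/eqP e2.
        by move: H; rewrite -e1 -e2 !mulr0 addr0 ltxx.
    have convm c : (c <= B)%N -> t = c%:R ->
        K ((1 - s) *: k (t / B%:R) + s *: psi (w t)).
      move=> cB tc; have [/(_ cB)[Mc cV] _] := mP c.
      apply: (conv (m c)) => // i [|]; first by rewrite tc; exact: cV.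
      by rewrite tc wm// => /psiP; exact.
    split.
      case: zb => [->|[->|[|]]].
      + by rewrite subr0 scale1r scale0r addr0.
      + by rewrite subrr scale1r scale0r add0r.
      + by apply: convm; exact: ltnW.
      + exact: convm.
    rewrite !mxE; have [->|sn] := eqVneq s 0; first by rewrite subr0 mul1r mul0r addr0.
    by apply: ltr_wpDl; [rewrite mulr_ge0 ?subr_ge0// ltW|rewrite mulr_gt0// lt_neqAle eq_sym sn].
have Fs (s t : R) : s = 0 \/ s = 1 -> 0 <= t <= B%:R -> F (s, t) = f (s, t).
  move=> s01 /(nat_interval B0)[b _ tb]; apply: (Ff 0%N b) => //.
  by split; [split=> //=; case: s01 => ->; rewrite ?lexx ?ler01|case: s01 => ->; tauto].
have Ft (s : R) b : I01 s -> (b = 0%N \/ b = B) -> F (s, b%:R) = f (s, b%:R).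
  move=> sI [->|->].
    by apply: (Ff 0%N 0%N) => //; split; [split=> //=; rewrite lexx ler01|tauto].
  apply: (Ff 0%N B.-1) => //; first by rewrite prednK.
  by split; rewrite /= ?prednK//; [split=> //=; rewrite prednK// lexx ler_nat leq_pred|tauto].
exists (fun z => F (z.1, B%:R * z.2)); split; [|split; [|split]].
- apply: within_comp cF _.
    apply: within_pair; first exact: within_fst.
    by apply: withinM; [exact: within_cst|exact: within_snd].
  by move=> z [z1 z2]; split=> //=; exact: I01_mul.
- move=> _ [z [z1 z2] <-]; apply: FK; exists (z.1, B%:R * z.2) => //.
  by split=> //=; exact: I01_mul.
- move=> t tI; have tB := I01_mul B tI.
  rewrite !Fs//; [|by right|by left]; rewrite /f/= mulrC mulKf//.
  by rewrite subr0 subrr !scale1r !scale0r addr0 add0r.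
- move=> s sI /=; rewrite mulr0 mulr1 (Ft s 0%N)//; last by left.
  rewrite (Ft s B)//; last by right.
  rewrite /f/= mul0r divff// -k01 (wm 0%N)// (wm B)// m0 mB k0.
  by rewrite -!scalerDl subrK scale1r.
Qed.

Let close u v := exists j, V j u /\ V j v.

(** The homotopy in the nerve is lifted over the vertices of a fine grid, then over its edges by
    paths inside single sets [V j], and last over its cells; this last extension is where small
    loops must contract. *)
Lemma nerve_map_inj (x0 : T) (g h : R -> T) : M x0 ->
  (forall u (l : R -> T), M u ->
    loop_in [set v | exists2 w, close u w & close w v] l -> contractible_in M l) ->
  based_loop M x0 g -> based_loop M x0 h ->
  homotopic_rel K (psi x0) (psi \o g) (psi \o h) -> homotopic_rel M x0 g h.
Proof.
move=> Mx0 small [[cg [g01 gM]] g0] [[ch [h01 hM]] h0] [H [cH [HK [Hgh Hx0]]]].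
have psiP := nerve_map_gt0 V_open V_cover.
have [j0 _] := V_cover Mx0.
have [B B0 HB] := star_subdivision cH HK.
have B0R : (0 : R) < B%:R by rewrite ltr0n.
have Bneq0 : (B%:R : R) != 0 by rewrite gt_eqF.
pose q (a b : nat) : R * R := (a%:R / B%:R, b%:R / B%:R).
have I01n b : (b <= B)%N -> I01 (b%:R / B%:R : R).
  by move=> bB; apply: I01_div => //; rewrite ler0n ler_nat.
have I01t b (t : R) : (b < B)%N -> b%:R <= t <= b.+1%:R -> I01 (t / B%:R).
  move=> bB /andP[bt tb]; apply: I01_div => //.
  by rewrite (le_trans _ bt)//= (le_trans tb)// ler_nat.
have /choice[j jP] : forall ab : nat * nat, exists j, (ab.1 < B)%N -> (ab.2 < B)%N ->
    forall z : R * R, cell ab.1 ab.2 z -> 0 < H (z.1 / B%:R, z.2 / B%:R) 0 j.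
  move=> [a b] /=; have [aB|Ba] := ltnP a B; last by exists j0.
  have [bB|Bb] := ltnP b B; last by exists j0.
  by have [j jH] := HB a b aB bB; exists j.
(* Lifted vertices. Those on the four sides are prescribed by [g], [h] and [x0], consistently at the
   corners because both loops are based at [x0]; every other one is a common point of the
   support. *)
have /choice[m mP] : forall ab : nat * nat, exists x, (ab.1 <= B)%N -> (ab.2 <= B)%N ->
    [/\ M x, forall j, 0 < H (q ab.1 ab.2) 0 j -> V j x,
     ab.1 = 0%N -> x = g (ab.2%:R / B%:R), ab.1 = B -> x = h (ab.2%:R / B%:R) &
     ab.2 = 0%N \/ ab.2 = B -> x = x0].
  move=> [a b] /=; have [aB|Ba] := leqP a B; last by exists x0.
  have [bB|Bb] := leqP b B; last by exists x0.
  have bI := I01n b bB; have aI := I01n a aB.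
  have gx0 : b = 0%N \/ b = B -> g (b%:R / B%:R) = x0.
    by case=> ->; rewrite ?mul0r ?divff// -g01.
  have hx0 : b = 0%N \/ b = B -> h (b%:R / B%:R) = x0.
    by case=> ->; rewrite ?mul0r ?divff// -h01.
  have [a0|a0] := eqVneq a 0%N.
    have Mg : M (g (b%:R / B%:R)) by apply: gM; exists (b%:R / B%:R).
    exists (g (b%:R / B%:R)) => _ _; split=> //.
      move=> i; rewrite /q a0 mul0r (Hgh _ bI).1 => /psiP; exact.
    by move=> aB'; move: B0; rewrite -aB' a0.
  have [eB|nB] := eqVneq a B.
    have Mh : M (h (b%:R / B%:R)) by apply: hM; exists (b%:R / B%:R).
    exists (h (b%:R / B%:R)) => _ _; split=> //.
      move=> i; rewrite /q eB divff// (Hgh _ bI).2 => /psiP; exact.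
    by move=> a0'; rewrite a0' in a0.
  have [b0|b0] := pselect (b = 0%N \/ b = B).
    exists x0 => _ _; split=> //.
    + have -> : H (q a b) = psi x0.
        by rewrite /q; case: b0 => ->; rewrite ?mul0r ?divff//; have [] := Hx0 _ aI.
      by move=> i /psiP; exact.
    + by move=> a0'; rewrite a0' in a0.
    + by move=> aB'; rewrite aB' eqxx in nB.
  have [|_ [_ [x [Mx xV]]]] := HK (H (q a b)); first by exists (q a b).
  exists x => _ _; split=> //.
  - by move=> a0'; rewrite a0' in a0.
  - by move=> aB'; rewrite aB' eqxx in nB.
(* The star assigned to a cell contains the images of its four corners, and each lifted corner
   belongs to every set in the support of its image. *)
have Vm a b a' b' : (a < B)%N -> (b < B)%N -> (a <= a' <= a.+1)%N ->
    (b <= b' <= b.+1)%N -> V (j (a, b)) (m (a', b')).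
  move=> aB bB /andP[a1 a2] /andP[b1 b2].
  have [] := mP (a', b') (leq_trans a2 aB) (leq_trans b2 bB) => _ + _ _ _; apply.
  by apply: (jP (a, b) aB bB (a'%:R, b'%:R)); split; rewrite /= !ler_nat ?a1 ?b1.
have closem a b : (a <= B)%N -> (b <= B)%N -> close (m (a, b)) (m (a, b)).
  by move=> aB bB; have [/V_cover[i iV] _ _ _ _] := mP (a, b) aB bB; exists i.
have Hg b (t : R) : (b < B)%N -> b%:R <= t <= b.+1%:R ->
    V (j (0%N, b)) (g (t / B%:R)).
  move=> bB tb; have tI := I01t _ _ bB tb.
  apply/psiP; first by apply: gM; exists (t / B%:R).
  have := jP (0%N, b) B0 bB (0, t); rewrite /= mul0r (Hgh _ tI).1; apply.
  by split=> //=; rewrite lexx ler01.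
have Hh b (t : R) : (b < B)%N -> b%:R <= t <= b.+1%:R ->
    V (j (B.-1, b)) (h (t / B%:R)).
  move=> bB tb; have tI := I01t _ _ bB tb.
  apply/psiP; first by apply: hM; exists (t / B%:R).
  have B1 : (B.-1 < B)%N by rewrite prednK.
  have := jP (B.-1, b) B1 bB (B%:R, t); rewrite /= divff// (Hgh _ tI).2; apply.
  by split=> //=; rewrite prednK// lexx ler_nat leq_pred.
pose seg := [set t : R | 0 <= t <= B%:R].
have segI (l : R -> T) : {within @I01 R, continuous l} ->
    {within seg, continuous (fun t => l (t / B%:R))}.
  move=> cl; apply: within_comp cl _; last by move=> t; exact: I01_div.
  by apply: withinM; [exact: within_id|exact: within_cst].
(* Lifts of the grid lines with constant first coordinate. The extreme ones are [g] and [h]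
   unchanged, so that the filled map has the required ends; the others are chained through the
   vertices. *)
have /choice[L LP] : forall a, exists w : R -> T, (a <= B)%N ->
    [/\ {within seg, continuous w}, forall b, (b <= B)%N -> w b%:R = m (a, b),
        forall b t, (b < B)%N -> b%:R <= t <= b.+1%:R -> close (m (a, b)) (w t),
        a = 0%N -> w = fun t => g (t / B%:R) & a = B -> w = fun t => h (t / B%:R)].
  move=> a; have [aB|Ba] := leqP a B; last by exists (fun=> x0).
  have [a0|a0] := eqVneq a 0%N.
    exists (fun t => g (t / B%:R)) => _; split=> //; first exact: segI.
    - by move=> b bB; have [_ _ -> //] := mP (a, b) aB bB.
    - move=> b t bB tb; exists (j (0%N, b)); split; last exact: Hg.
      by rewrite a0; apply: Vm => //; rewrite leqnn leqnSn.
    - by move=> aB'; move: B0; rewrite -aB' a0.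
  have [eB|nB] := eqVneq a B.
    exists (fun t => h (t / B%:R)) => _; split=> //; first exact: segI.
    - by move=> b bB; have [_ _ _ -> //] := mP (a, b) aB bB.
    - move=> b t bB tb; exists (j (B.-1, b)); split; last exact: Hh.
      rewrite eB; apply: Vm; rewrite ?leqnn ?leqnSn// ?prednK//.
      by rewrite leqnn leq_pred.
    - by move=> a0'; rewrite a0' in a0.
  have aB' : (a < B)%N by rewrite ltn_neqAle nB.
  have [|w [cw [wm wV]]] := @chain_path R T B (fun b => m (a, b)) (fun b => V (j (a, b))) B0.
    by move=> b bB; apply: V_joined; apply: Vm; rewrite // ?leqnn ?leqnSn.
  exists w => _; split=> //.
  - move=> b t bB tb; exists (j (a, b)); split; last exact: wV.
    by apply: Vm; rewrite // ?leqnn ?leqnSn.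
  - by move=> a0'; rewrite a0' in a0.
  - by move=> eB; rewrite eB eqxx in nB.
have /choice[W WP] : forall b, exists w : R -> T, (b <= B)%N ->
    [/\ {within seg, continuous w}, forall a, (a <= B)%N -> w a%:R = m (a, b),
        forall a t, (a < B)%N -> a%:R <= t <= a.+1%:R -> close (m (a, b)) (w t) &
        b = 0%N \/ b = B -> w = fun=> x0].
  move=> b; have [bB|Bb] := leqP b B; last by exists (fun=> x0).
  have [b0|b0] := pselect (b = 0%N \/ b = B).
    exists (fun=> x0) => _; split=> //; first exact: within_cst.
    - by move=> a aB; have [_ _ _ _ ->] := mP (a, b) aB bB.
    - move=> a t aB _; have [_ _ _ _ /(_ b0) e] := mP (a, b) (ltnW aB) bB.
      by rewrite -e; apply: closem => //; exact: ltnW.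
  have bB' : (b < B)%N.
    by rewrite ltn_neqAle bB andbT; apply/eqP => e; apply: b0; right.
  have [|w [cw [wm wV]]] := @chain_path R T B (fun a => m (a, b)) (fun a => V (j (a, b))) B0.
    by move=> a aB; apply: V_joined; apply: Vm; rewrite // ?leqnn ?leqnSn.
  exists w => _; split=> //.
  move=> a t aB tb; exists (j (a, b)); split; last exact: wV.
  by apply: Vm; rewrite // ?leqnn ?leqnSn.
(* The two families of lines combine to one map because at a crossing both take the value
   [m (a, b)]; off the lines the value is arbitrary. *)
have /choice[f fP] : forall z : R * R, exists u,
    (forall a, (a <= B)%N -> z.1 = a%:R -> u = L a z.2) /\
    (forall b, (b <= B)%N -> z.2 = b%:R -> u = W b z.1).
  move=> [s t] /=; have [[a [aB sa]]|nsa] := pselect (exists a, (a <= B)%N /\ s = a%:R).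
    exists (L a t); split=> [a' _|b bB tb].
      by rewrite sa => /eqP; rewrite eqr_nat => /eqP ->.
    have [_ Lm _ _ _] := LP a aB; have [_ Wm _ _] := WP b bB.
    by rewrite sa tb Lm// Wm.
  have [[b [bB tb]]|ntb] := pselect (exists b, (b <= B)%N /\ t = b%:R).
    exists (W b s); split=> [a aB sa|b' _]; first by exfalso; apply: nsa; exists a.
    by rewrite tb => /eqP; rewrite eqr_nat => /eqP ->.
  exists x0; split=> [a aB sa|b bB tb]; first by exfalso; apply: nsa; exists a.
  by exfalso; apply: ntb; exists b.
have fL a (s t : R) : (a <= B)%N -> s = a%:R -> f (s, t) = L a t.
  by move=> aB sa; have [/(_ a aB sa)] := fP (s, t).
have fW b (s t : R) : (b <= B)%N -> t = b%:R -> f (s, t) = W b s.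
  by move=> bB tb; have [_ /(_ b bB tb)] := fP (s, t).
have in_seg a (s : R) : (a < B)%N -> a%:R <= s <= a.+1%:R -> seg s.
  move=> aB /andP[s0 s1]; rewrite /seg/= (le_trans _ s0)//= (le_trans s1)//.
  by rewrite ler_nat.
have [//|//||F [cF [FM Ff]]] := @fill_grid R _ M
    (fun a b => [set v | exists2 w, close (m (a, b)) w & close w v]) f B B.
  move=> a b aB bB; split.
  - by move=> l; apply: small; have [] := mP (a, b) (ltnW aB) (ltnW bB).
  (* The four closed edges of the cell: the first boolean selects the direction, the second the
     lower or the upper edge. *)
  - pose E (i : bool * bool) : set (R * R) := if i.1 then
      [set z | z.1 = (a + i.2)%:R /\ b%:R <= z.2 <= b.+1%:R] else
      [set z | z.2 = (b + i.2)%:R /\ a%:R <= z.1 <= a.+1%:R].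
    have -> : cell_boundary a b = \bigcup_i E i.
      apply/seteqP; split=> [z [[z1 z2] zb]|z [[[] e] _ /= [z1 z2]]].
      + case: zb => [e|[e|[e|e]]].
        * by exists (true, false) => //; rewrite /E/= addn0.
        * by exists (true, true) => //; rewrite /E/= addn1.
        * by exists (false, false) => //; rewrite /E/= addn0.
        * by exists (false, true) => //; rewrite /E/= addn1.
      + split; first by split=> //; rewrite z1 !ler_nat; case: e {z1}; rewrite ?addn0 ?addn1 ?leqnn ?leqnSn.
        by case: e z1; rewrite ?addn0 ?addn1 => ->; tauto.
      + split; first by split=> //; rewrite z1 !ler_nat; case: e {z1}; rewrite ?addn0 ?addn1 ?leqnn ?leqnSn.
        by case: e z1; rewrite ?addn0 ?addn1 => ->; tauto.
    have closed_line (c : R) : closed [set t : R | t = c].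
      have -> : [set t : R | t = c] = [set t : R | c <= t <= c].
        by apply/seteqP; split=> t /=; [move=> ->; rewrite lexx|move=> /le_anti].
      exact: closed_itvcc.
    apply: paste_closed.
      case=> [[] e]; rewrite /E/=.
      * have -> : [set z : R * R | z.1 = (a + e)%:R /\ b%:R <= z.2 <= b.+1%:R] =
          (fst @^-1` [set t : R | t = (a + e)%:R]) `&`
          (snd @^-1` [set t : R | b%:R <= t <= b.+1%:R]) by [].
        by apply: closedI; apply: (@closed_comp (R * R)%type R);
          first [exact: closed_itvcc|exact: closed_line|
            move=> z _; exact: cvg_fst|move=> z _; exact: cvg_snd].
      * have -> : [set z : R * R | z.2 = (b + e)%:R /\ a%:R <= z.1 <= a.+1%:R] =
          (snd @^-1` [set t : R | t = (b + e)%:R]) `&`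
          (fst @^-1` [set t : R | a%:R <= t <= a.+1%:R]) by [].
        by apply: closedI; apply: (@closed_comp (R * R)%type R);
          first [exact: closed_itvcc|exact: closed_line|
            move=> z _; exact: cvg_fst|move=> z _; exact: cvg_snd].
    case=> [[] e]; rewrite /E/=.
    + have aeB : (a + e <= B)%N by case: e; rewrite ?addn0 ?addn1// ltnW.
      have [cL _ _ _ _] := LP _ aeB.
      apply: (@eq_within_continuous _ _ _ (fun z => L (a + e)%N z.2)).
        by move=> [s t] /= [sa _]; rewrite (fL (a + e)%N).
      apply: within_comp cL _; first exact: within_snd.
      by move=> z [_ /(in_seg _ _ bB)].
    + have beB : (b + e <= B)%N by case: e; rewrite ?addn0 ?addn1// ltnW.
      have [cW _ _ _] := WP _ beB.
      apply: (@eq_within_continuous _ _ _ (fun z => W (b + e)%N z.1)).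
        by move=> [s t] /= [tb _]; rewrite (fW (b + e)%N).
      apply: within_comp cW _; first exact: within_fst.
      by move=> z [_ /(in_seg _ _ aB)].
  - move=> _ [[s t] [[/= sa tb] zb] <-].
    (* The two edges through the corner [m (a, b)] are one step of [close] away from it. The
       opposite two are reached through [m (a.+1, b)] or [m (a, b.+1)], which is why loops within
       two steps have to be contractible. *)
    case: zb => [e|[e|[e|e]]].
    + rewrite (fL a)//; last exact: ltnW.
      have [_ _ Lc _ _] := LP a (ltnW aB); exists (m (a, b)); last exact: Lc.
      by apply: closem; exact: ltnW.
    + rewrite (fL a.+1)//.
      have [_ _ Lc _ _] := LP a.+1 aB; exists (m (a.+1, b)); last exact: Lc.
      by exists (j (a, b)); split; apply: Vm; rewrite // ?leqnn ?leqnSn.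
    + rewrite (fW b)//; last exact: ltnW.
      have [_ _ Wc _] := WP b (ltnW bB); exists (m (a, b)); last exact: Wc.
      by apply: closem; exact: ltnW.
    + rewrite (fW b.+1)//.
      have [_ _ Wc _] := WP b.+1 bB; exists (m (a, b.+1)); last exact: Wc.
      by exists (j (a, b)); split; apply: Vm; rewrite // ?leqnn ?leqnSn.
have B1 : (B.-1 < B)%N by rewrite prednK.
have F0 (t : R) : I01 t -> F (0, B%:R * t) = g t /\ F (B%:R, B%:R * t) = h t.
  move=> tI; have /(nat_interval B0)[b _ tb] := I01_mul B tI; split.
    rewrite (Ff 0%N b)//; last first.
      by split; [split=> //=; rewrite lexx ler01|left].
    rewrite (fL 0%N)//; have [_ _ _ -> // _] := LP 0%N (leq0n B).
    by rewrite mulrAC divff// mul1r.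
  rewrite (Ff B.-1 b)//; last first.
    by split; rewrite /= ?prednK//; [split=> //=; rewrite prednK// lexx ler_nat leq_pred|tauto].
  rewrite (fL B)//; have [_ _ _ _ -> //] := LP B (leqnn B).
  by rewrite mulrAC divff// mul1r.
have F1 (s : R) : I01 s -> F (B%:R * s, 0) = x0 /\ F (B%:R * s, B%:R) = x0.
  move=> sI; have /(nat_interval B0)[a _ sa] := I01_mul B sI; split.
    rewrite (Ff a 0%N)//; last first.
      by split; [split=> //=; rewrite lexx ler01|tauto].
    by rewrite (fW 0%N)//; have [_ _ _ -> //] := WP 0%N (leq0n B); left.
  rewrite (Ff a B.-1)//; last first.
    by split; rewrite /= ?prednK//; [split=> //=; rewrite prednK// lexx ler_nat leq_pred|tauto].
  by rewrite (fW B)//; have [_ _ _ -> //] := WP B (leqnn B); right.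
have sqgrid (z : R * R) : sq01 z -> grid B B (B%:R * z.1, B%:R * z.2).
  by move=> [z1 z2]; split; exact: I01_mul.
exists (fun z => F (B%:R * z.1, B%:R * z.2)); split; [|split; [|split]].
- apply: within_comp cF sqgrid.
  by apply: within_pair; apply: withinM; try exact: within_cst;
    [exact: within_fst|exact: within_snd].
- by move=> _ [z /sqgrid zB <-]; apply: FM; exists (B%:R * z.1, B%:R * z.2).
- by move=> t /F0 /=; rewrite mulr0 mulr1.
- by move=> s /F1 /=; rewrite mulr0 mulr1.
Qed.

Lemma nerve_map_pi1_iso :
  (forall u (l : R -> T), M u ->
    loop_in [set v | exists2 w, close u w & close w v] l -> contractible_in M l) ->
  induces_pi1_iso R M K psi.
Proof.
move=> small x0 Mx0; split=> [g h bg bh|k bk]; first exact: nerve_map_inj.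
exact: nerve_map_surj.
Qed.

End NerveIso.

Section NervePolyhedron.
Variables (R : realType) (T : pseudoMetricType R) (M : set T).
Variables (r d : nat) (V : 'I_r -> set T) (col : 'I_r -> 'I_d.+1).
Hypothesis V_col : forall i j x, V i x -> V j x -> col i = col j -> i = j.

Let face (s : {set 'I_r}) : bool :=
  `[< s != finset.set0 /\ exists x, M x /\ forall j, j \in s -> V j x >].

Let enumerate (s : {set 'I_r}) : s != finset.set0 ->
  exists e : 'I_(#|s|.-1).+1 -> 'I_r, injective e /\ e @: finset.setT = s.
Proof.
rewrite -card_gt0 => s0.
exists (fun i => enum_val (cast_ord (prednK s0) i)); split.
  by move=> i i' /enum_val_inj/cast_ord_inj.
apply/setP => j; apply/imsetP/idP => [[i _ ->]|js]; first exact: enum_valP.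
exists (cast_ord (esym (prednK s0)) (enum_rank_in js j)); first by rewrite finset.in_setT.
by rewrite cast_ordKV enum_rankK_in.
Qed.

(** One simplex per face, spanned by standard basis vectors. Sets with a common point have different
    colours, so [col] is injective on a face, which therefore has at most [d.+1] vertices. Local
    finiteness holds because there are finitely many faces. *)
Lemma nerve_polyhedron : polyhedron d (nerve M V).
Proof.
have E (s : {s | face s}) : {e : 'I_(#|sval s|.-1).+1 -> 'I_r |
    injective e /\ e @: finset.setT = sval s}.
  by apply: cid; case: s => s fs /=; apply: enumerate; have [] := asboolP _ fs.
pose e s := sval (E s); have eP s : injective (e s) /\ e s @: finset.setT = sval s.
  exact: svalP (E s).
have sumE (s : {s | face s}) (F : 'I_r -> R) :
    \sum_i F (e s i) = \sum_(j in sval s) F j.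
  have [ei es] := eP s.
  transitivity (\sum_(j in e s @: finset.setT) F j); last by rewrite es.
  rewrite big_imset/=; last by move=> ? ? _ _; exact: ei.
  by apply: eq_bigl => i; rewrite finset.in_setT.
have e_in (s : {s | face s}) i : e s i \in sval s.
  have [_ es] := eP s; have : e s i \in e s @: finset.setT by rewrite imset_f ?finset.in_setT.
  by rewrite es.
have e_surj (s : {s | face s}) j : j \in sval s -> exists i, e s i = j.
  have [_ es] := eP s; move=> js; have : j \in e s @: finset.setT by rewrite es.
  by move=> /imsetP[i _ ->]; exists i.
have combE (s : {s | face s}) (t : 'I_(#|sval s|.-1).+1 -> R) j :
    (\sum_i t i *: delta_mx 0 (e s i) : 'rV[R]_r) 0 j = \sum_(i | e s i == j) t i.
  rewrite summxE [RHS]big_mkcond/=; apply: eq_bigr => i _.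
  by rewrite !mxE eqxx/= eq_sym; case: eqP => _; rewrite ?mulr1 ?mulr0.
exists {s | face s}, (fun s : {s | face s} => #|sval s|.-1),
  (fun (s : {s | face s}) i => delta_mx 0 (e s i)).
split; [|split; [|split]].
- move=> [s fs] /=; have [s0 [x [_ xV]]] := asboolP _ fs.
  rewrite -ltnS prednK ?card_gt0// -[d.+1]card_ord.
  rewrite -(@card_in_imset _ _ col) ?max_card// => i j /xV Vi /xV Vj; exact: V_col Vi Vj.
- move=> s; have [ei _] := eP s; apply/row_freeP.
  (* This right inverse reads off the coordinates of the vertices other than the base vertex. *)
  exists (\matrix_(j, i) (j == e s (lift ord0 i))%:R).
  apply/matrixP => i i'; rewrite !mxE.
  under eq_bigr do rewrite !mxE eqxx/= mulrBl.
  rewrite sumrB (bigD1 (e s (lift ord0 i)))//= eqxx mul1r big1 ?addr0; last first.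
    by move=> j /negbTE ->; rewrite mul0r.
  rewrite (bigD1 (e s ord0))//= eqxx mul1r big1 ?addr0; last first.
    by move=> j /negbTE ->; rewrite mul0r.
  by rewrite !(inj_eq ei) (inj_eq (@lift_inj _ _)) (negbTE (neq_lift _ _)) subr0.
- apply/seteqP; split=> [y [y0 [y1 [x [Mx xV]]]]|y [s _ [t [t0 [t1 ->]]]]].
    pose s := [set j | 0 < y 0 j]%SET.
    have ys j : j \notin s -> y 0 j = 0.
      by rewrite inE -leNgt => h; apply/eqP; rewrite eq_le h y0.
    have fs : face s.
      apply/asboolP; split; last by exists x; split=> // j; rewrite inE; exact: xV.
      apply/negP => /eqP s0; have /eqP := y1.
      by rewrite big1 ?(eq_sym 0) ?oner_eq0// => j _; apply: ys; rewrite s0 inE.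
    exists (exist _ s fs) => //; exists (fun i => y 0 (e (exist _ s fs) i)).
    split=> //; split.
      transitivity (\sum_(j in s) y 0 j); first exact: (sumE (exist _ s fs) (fun j => y 0 j)).
      rewrite -[RHS]y1 [RHS](bigID (mem s))/=.
      by rewrite [X in _ = _ + X]big1 ?addr0.
    have [ei es] := eP (exist _ s fs).
    apply/rowP => j.
    transitivity (\sum_(i | e (exist _ s fs) i == j) y 0 (e (exist _ s fs) i));
      last exact/esym/combE.
    have [js|js] := boolP (j \in s).
      have [i <-] := @e_surj (exist _ s fs) j js.
      by rewrite (big_pred1 i)// => i'; rewrite (inj_eq ei).
    rewrite ys// big1// => i /eqP eij; move: js.
    by rewrite -eij (e_in (exist _ s fs)).
  have [s0 [x [Mx xV]]] := asboolP _ (svalP s).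
  have [ei es] := eP s.
  split; [|split].
  + by move=> j; rewrite combE sumr_ge0.
  + under eq_bigr do rewrite combE.
    by rewrite -[RHS]t1 [RHS](partition_big (e s) predT).
  + exists x; split=> // j; rewrite combE => h; apply: xV.
    apply: contraTT h => nj; rewrite big1 ?ltxx// => i /eqP eij.
    by move: nj; rewrite -eij e_in.
- by move=> c; exact: finite_finset.
Qed.
End NervePolyhedron.

(** * Local contractibility of submanifolds *)

Lemma linfE (R : realType) (m : nat) (x : 'rV[R]_m) : linf x = `|x|.
Proof.
have -> : `|x| = \big[Num.max/0]_ij `|x ij.1 ij.2| by exact: mx_normrE.
rewrite /linf; apply/eqP; rewrite eq_le; apply/andP; split.
  apply: bigmax_le => [|i _]; first exact: bigmax_ge_id.
  exact: (@le_bigmax _ _ _ _ (fun ij => `|x ij.1 ij.2|) (0, i)).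
apply: bigmax_le => [|[i j] _]; first exact: bigmax_ge_id.
by rewrite /= ord1; exact: (@le_bigmax _ _ _ _ (fun i => `|x 0 i|)).
Qed.

Section Charts.
Variables (R : realType) (n N : nat) (M : set 'rV[R]_N).
Hypothesis M_mfd : closed_C1_submanifold n M.

(** In a chart, [P] consists of the points whose coordinates lie in a ball around those of [p];
    segments to its centre give both the paths and the contraction. The paths stay in the given [O],
    which later makes path components open in [M]. *)
Lemma locally_contractible p (O : set 'rV[R]_N) : M p -> nbhs p O ->
  exists2 P, nbhs p P &
    (forall y, M y -> P y -> joined R (M `&` O) p y) /\
    (forall l : R -> 'rV[R]_N, loop_in (M `&` P) l -> contractible_in M l).
Proof.
move=> Mp pO; have [U [V [f [oU [Up chart]]]]] := M_mfd.2 p Mp.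
have [oV [cf [_ [_ [fV [g [gf cg]]]]]]] := chart.
have [v0 Vv0 fv0] : (f @` V) p by rewrite fV.
have nV : nbhs v0 V by apply: open_nbhs_nbhs.
have nO : nbhs v0 [set z | V z -> O (f z)].
  by move/within_continuousP : cf; apply=> //; rewrite fv0.
have : nbhs v0 (V `&` [set z | V z -> O (f z)]) by exact: filterI.
move=> /nbhs_ballP[e /= e0 eV].
have segV v t : ball v0 e v -> I01 t -> ball v0 e (v + t *: (v0 - v)).
  rewrite -ball_normE /= => ve /andP[t0 t1].
  have -> : v0 - (v + t *: (v0 - v)) = (1 - t) *: (v0 - v).
    by rewrite scalerBl scale1r opprD addrA.
  rewrite normrZ ger0_norm ?subr_ge0//; apply: le_lt_trans ve.
  by rewrite ler_piMl// gerBl.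
have fM v : V v -> M (f v).
  by move=> Vv; have [] : (M `&` U) (f v) by rewrite -fV; exists v.
have nP : nbhs p [set z | (M `&` U) z -> ball v0 e (g z)].
  move/within_continuousP : cg; apply=> //.
  by rewrite -fv0 gf//; exact: nbhsx_ballx.
have nU : nbhs p U by apply: open_nbhs_nbhs.
exists (U `&` [set z | (M `&` U) z -> ball v0 e (g z)]); first exact: filterI.
have fg y : (M `&` U) y -> f (g y) = y.
  by rewrite -fV => -[v Vv <-]; rewrite gf.
split.
  move=> y My [Uy /(_ (conj My Uy)) gy].
  exists (fun t => f (g y + (1 - t) *: (v0 - g y))).
  have I1 t : I01 t -> I01 (1 - t) by rewrite /I01/=; lra.
  split.
    apply: within_comp cf _; last by move=> t /I1 /(segV _ _ gy)/eV[].
    apply: withinD; first exact: within_cst.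
    apply: withinZ; last exact: within_cst.
    by apply: withinB; [exact: within_cst|exact: within_id].
  split; first by rewrite subr0 scale1r addrC subrK.
  split; first by rewrite subrr scale0r addr0; apply: fg.
  by move=> _ [t /I1 /(segV _ _ gy)/eV[Vt Ot] <-]; split; [exact: fM|exact: Ot].
move=> l [cl [l01 lMP]].
have lP t : I01 t -> (M `&` U) (l t) /\ ball v0 e (g (l t)).
  move=> tI; have [|Mt [Ut gt]] := lMP (l t); first by exists t.
  by split=> //; exact: gt.
exists (fun z => f (g (l z.2) + z.1 *: (v0 - g (l z.2)))).
have cgl : {within @sq01 R, continuous (fun z => g (l z.2))}.
  apply: within_comp cg _; last by move=> z [_ /lP[]].
  by apply: within_comp cl _; [exact: within_snd|move=> z []].
split; [|split; [|split]].
- apply: within_comp cf _.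
    apply: withinD => //; apply: withinZ; first exact: within_fst.
    by apply: withinB => //; exact: within_cst.
  by move=> z [z1 /lP[_ gl]]; have [] := eV _ (segV _ _ gl z1).
- move=> _ [z [z1 /lP[_ gl]] <-]; apply: fM.
  by have [] := eV _ (segV _ _ gl z1).
- move=> t tI /=; rewrite scale0r addr0 !scale1r ![_ + (v0 - _)]addrC !subrK.
  by split=> //; apply: fg; have [] := lP t tI.
- by move=> s _ /=; rewrite l01.
Qed.

Lemma small_loops_contractible : exists2 e : R, 0 < e &
  forall (l : R -> 'rV[R]_N) c, loop_in M l ->
    (forall t, I01 t -> linf (l t - c) <= e) -> contractible_in M l.
Proof.
have [|||e e0 He] := @lebesgue_number R _ M
    (fun C => forall l : R -> 'rV[R]_N, loop_in (M `&` C) l -> contractible_in M l).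
- exact: M_mfd.1.
- move=> B C BC H l [cl [l01 lB]]; apply: H; split=> //; split=> //.
  by move=> _ [t tI <-]; have [|Mt /BC Ct] := lB (l t); [exists t|split].
- move=> p Mp; have [P /nbhs_ballP[e /= e0 eP] [_ H]] := locally_contractible Mp filterT.
  exists e => // l [cl [l01 lB]]; apply: H; split=> //; split=> //.
  by move=> _ [t tI <-]; have [|Mt /eP Ct] := lB (l t); [exists t|split].
(* The centre [c] need not lie on [M], while the Lebesgue number concerns balls around points of
   [M]; recentring at [l 0] costs a factor 2, and [2 e / 3 < e]. *)
exists (e / 3) => [|l c [cl [l01 lM]] lc]; first by rewrite divr_gt0.
have I0 : I01 (0 : R) by rewrite /I01/= lexx ler01.
have Ml0 : M (l 0) by apply: lM; exists 0.
apply: (He _ Ml0); split=> //; split=> //.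
move=> _ [t tI <-]; split; first by apply: lM; exists t.
rewrite -ball_normE /=; have := lc _ I0; have := lc _ tI; rewrite !linfE => h1 h2.
have -> : l 0 - l t = (l 0 - c) - (l t - c) by rewrite opprB addrA subrK.
by have := ler_normB (l 0 - c) (l t - c); lra.
Qed.
End Charts.

(** * Grids in general position *)

Section GenericGrid.
Variables (R : realType) (N d : nat).

(** Projected to more than [k] coordinates, a simplex of dimension [k] lies in a proper affine
    subspace. The form comes from the left kernel of the matrix of its edge vectors restricted to
    the columns in [S]. *)
Lemma simplex_linear_form (k : nat) (v : 'I_k.+1 -> 'rV[R]_N) (S : {set 'I_N}) :
  (k < #|S|)%N -> exists (u : 'I_N -> R) (beta : R),
    [/\ exists i, u i != 0, forall i, i \notin S -> u i = 0 &
        forall x, simplex v x -> \sum_i u i * x 0 i = beta].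
Proof.
move=> kS.
pose A : 'M[R]_(#|S|, k) := \matrix_(i, l) (v (lift ord0 l) - v ord0) 0 (enum_val i).
have kA : kermx A != 0.
  by rewrite -mxrank_eq0 mxrank_ker -lt0n subn_gt0 (leq_ltn_trans (rank_leq_col A)).
have /rowV0Pn[w /sub_kermxP wA w0] := kA.
have [s0 s0S] : exists s0, s0 \in S by apply/card_gt0P; apply: leq_ltn_trans kS.
pose u i := if i \in S then w 0 (enum_rank_in s0S i) else 0.
have uE (F : 'I_N -> R) : \sum_i u i * F i = \sum_j w 0 j * F (enum_val j).
  rewrite (bigID (mem S))/= [X in _ + X]big1 ?addr0; last first.
    by move=> i /negbTE iS; rewrite /u iS mul0r.
  rewrite big_enum_val/=; apply: eq_bigr => j _.
  by rewrite /u enum_valP enum_valK_in.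
have uv l : \sum_i u i * v l 0 i = \sum_i u i * v ord0 0 i.
  case: (unliftP ord0 l) => [l' ->|->//].
  apply/eqP; rewrite -subr_eq0 -sumrB; apply/eqP.
  transitivity (\sum_j w 0 j * A j l').
    under eq_bigr do rewrite -mulrBr.
    rewrite (uE (fun i => v (lift ord0 l') 0 i - v ord0 0 i)).
    by apply: eq_bigr => j _; rewrite !mxE.
  by have /matrixP/(_ 0 l') := wA; rewrite !mxE.
exists u, (\sum_i u i * v ord0 0 i); split.
- have /rV0Pn[j wj] := w0; exists (enum_val j).
  by rewrite /u enum_valP enum_valK_in.
- by move=> i /negbTE iS; rewrite /u iS.
- move=> x [t [t0 [t1 ->]]].
  under eq_bigr do rewrite summxE mulr_sumr.
  rewrite exchange_big/=.
  under eq_bigr => l _.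
    under eq_bigr do rewrite !mxE mulrCA.
    rewrite -mulr_sumr uv; over.
  by rewrite -mulr_suml t1 mul1r.
Qed.

Lemma finite_roots (p : {poly R}) : p != 0 -> finite_set [set t | root p t].
Proof.
move=> p0; apply: contrapT => /(infinite_set_fset (size p))[B Bp].
apply/negP; rewrite -ltnNge; apply: max_poly_roots => //.
  by apply/allP => t tB; exact: Bp.
exact: finmap.fset_uniq.
Qed.

(** The unit interval has positive Lebesgue measure, whereas countable sets are null. *)
Lemma countable_avoid (A : set R) : countable A -> exists t, ~ A t.
Proof.
move=> cA; apply: contrapT => /forallNP nA.
have : countable (`[0, 1]%classic : set R).
  by apply: sub_countable cA; apply: subset_card_le => t _; apply: contrapT; exact: nA.
move=> /countable_lebesgue_measure0; rewrite lebesgue_measure_itv/= lte01 oppr0 adde0.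
by move=> /eqP; rewrite eqe oner_eq0.
Qed.

(* The shift is taken on the moment curve, which meets a countable family of
   hyperplanes in a countable set of parameters. *)
Lemma generic_shift (K C : set 'rV[R]_N) (rho delta : R) : polyhedron d K ->
  C `<=` K -> (forall x, C x -> linf x <= rho) ->
  exists a : 'I_N -> R, forall x (S : {set 'I_N}) (k : 'I_N -> int), C x ->
    (forall i, i \in S -> x 0 i - a i = delta * (k i)%:~R) -> (#|S| <= d)%N.
Proof.
move=> [I [dim [v [dimd [_ [KE Kfin]]]]]] CK Crho.
have /choice[p pP] : forall isk : I * ({set 'I_N} * {ffun 'I_N -> int}),
    exists p : {poly R}, p != 0 /\ forall x t, (d < #|isk.2.1|)%N ->
      simplex (v isk.1) x ->
      (forall i, i \in isk.2.1 -> x 0 i - t ^+ i.+1 = delta * (isk.2.2 i)%:~R) ->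
      root p t.
  move=> [i [S k]] /=; have [dS|Sd] := ltnP d #|S|; last first.
    by exists 1; split; [exact: oner_neq0|].
  have [u [beta [[i0 ui0] uS uv]]] := simplex_linear_form (v i) (leq_ltn_trans (dimd i) dS).
  (* Substituting [x 0 i = t ^+ i.+1 + delta * k i] on [S] in the linear form gives this polynomial
     equation for [t]. Exponents start at 1 so that the constant term [c] cannot cancel the nonzero
     coefficient [u i0]. *)
  pose c := delta * (\sum_j u j * (k j)%:~R) - beta.
  exists (\sum_j u j *: 'X^(j.+1) + c%:P); split.
    apply: contra_neq ui0 => /(congr1 (fun q : {poly R} => q`_i0.+1)).
    rewrite coef0 coefD coefC/= addr0 coef_sum (bigD1 i0)//= coefZ coefXn eqxx mulr1.
    rewrite big1 ?addr0// => j ji; rewrite coefZ coefXn eqSS.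
    by rewrite (negbTE (_ : (i0 : nat) != j)) ?mulr0// eq_sym.
  move=> x t _ xv xS; rewrite /root hornerD hornerC horner_sum.
  under eq_bigr do rewrite hornerZ hornerXn.
  rewrite /c addrA subr_eq0 -(uv x xv) mulr_sumr -big_split/=; apply/eqP.
  apply: eq_bigr => j _; have [jS|jS] := boolP (j \in S); last by rewrite uS// !mul0r mulr0 addr0.
  by rewrite mulrCA -mulrDr -xS// addrC subrK.
(* Local finiteness of the polyhedron leaves finitely many simplices meeting the ball of radius
   [rho]; there are countably many pairs of a set and integer values, and finitely many roots for
   each. *)
have [t nt] : exists t, ~ (\bigcup_(i in [set i | exists y, simplex (v i) y /\ linf y <= rho])
    \bigcup_(sk : {set 'I_N} * {ffun 'I_N -> int}) [set t | root (p (i, sk)) t]) t.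
  apply: countable_avoid; apply: bigcup_countable => [|i _].
    exact: finite_set_countable (Kfin rho).
  apply: bigcup_countable => [|sk _]; first exact: countableP.
  by apply: finite_set_countable; apply: finite_roots; have [] := pP (i, sk).
exists (fun i => t ^+ i.+1) => x S k Cx xS; rewrite leqNgt; apply/negP => dS.
have : K x by exact: CK.
rewrite KE => -[i _ xi]; apply: nt.
exists i; first by exists x; split=> //; exact: Crho.
exists (S, [ffun j => k j]) => //=.
have [_ /(_ x t dS xi)] := pP (i, (S, [ffun j => k j])); apply => j jS /=.
by rewrite ffunE xS.
Qed.
End GenericGrid.

Section ColoredCover.
Variables (R : realType) (N d : nat) (a : 'I_N -> R) (delta : R).
Hypothesis delta0 : 0 < delta.

Let y (x : 'rV[R]_N) i : R := (x 0 i - a i) / delta.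

(* The handle around the open face of the grid [a + delta Z^N] where exactly the
   coordinates in [S] are constant, equal to [a + delta k]: each of them is closer
   to the grid than all the others. *)
Definition handle (Sk : {set 'I_N} * {ffun 'I_N -> int}) : set 'rV[R]_N :=
  [set x | (#|Sk.1| <= d)%N /\
    (forall i, i \in Sk.1 -> `|y x i - (Sk.2 i)%:~R| < 2^-1) /\
    (forall j, j \notin Sk.1 -> 0 < y x j - (Sk.2 j)%:~R < 1) /\
    (forall i j, i \in Sk.1 -> j \notin Sk.1 ->
      `|y x i - (Sk.2 i)%:~R| < y x j - (Sk.2 j)%:~R /\
      `|y x i - (Sk.2 i)%:~R| < 1 - (y x j - (Sk.2 j)%:~R))].

Lemma handle_open Sk : open (handle Sk).
Proof.
case: Sk => S k; rewrite openE => x [/= Sd [x1 [x2 x3]]].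
have cst (c : R) : continuous (fun _ : 'rV[R]_N => c) by exact: cst_continuous.
have cy i : continuous (fun z => y z i - (k i)%:~R).
  have cx : continuous (fun z : 'rV[R]_N => z 0 i) by exact: coord_continuous.
  move=> z; exact: (cvgB (cvgM (cvgB (cx z) (cst (a i) z)) (cst delta^-1 z)) (cst _ z)).
have cny i : continuous (fun z => `|y z i - (k i)%:~R|).
  move=> z; apply: (@continuous_comp _ _ _ (fun z => y z i - (k i)%:~R) (fun t : R => `|t|)).
    exact: cy.
  exact: norm_continuous.
have near_lt (f g : 'rV[R]_N -> R) : continuous f -> continuous g -> f x < g x ->
    \forall z \near x, f z < g z.
  move=> cf cg fg; have cgf : continuous (fun z => g z - f z).
    by move=> z; exact: (cvgB (cg z) (cf z)).
  have : nbhs x [set z | 0 < g z - f z].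
    by apply: (cgf x [set t | 0 < t]); apply: lt_nbhsr; rewrite subr_gt0.
  by apply: filterS => z /=; rewrite subr_gt0.
have near_imp (b : bool) (P : set 'rV[R]_N) : (b -> nbhs x P) ->
    nbhs x [set z | b -> P z].
  case: b => H; last exact: filterE.
  by apply: filterS (H isT) => z Pz _.
have n1 : nbhs x [set z | forall i, i \in S -> `|y z i - (k i)%:~R| < 2^-1].
  apply: nbhs_forall => i; apply: near_imp => iS.
  by apply: near_lt; [exact: cny|exact: cst_continuous|exact: x1].
have n2 : nbhs x [set z | forall j, j \notin S -> 0 < y z j - (k j)%:~R < 1].
  apply: nbhs_forall => j; apply: near_imp => jS.
  have /andP[h1 h2] := x2 j jS.
  have m1 : \forall z \near x, 0 < y z j - (k j)%:~R.
    by apply: (near_lt (fun=> 0)); [exact: cst_continuous|exact: cy|].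
  have m2 : \forall z \near x, y z j - (k j)%:~R < 1.
    by apply: (near_lt _ (fun=> 1)); [exact: cy|exact: cst_continuous|].
  by apply: filterS (filterI m1 m2) => z [z1 z2] /=; rewrite z1.
have n3 : nbhs x [set z | forall i j, i \in S -> j \notin S ->
    `|y z i - (k i)%:~R| < y z j - (k j)%:~R /\
    `|y z i - (k i)%:~R| < 1 - (y z j - (k j)%:~R)].
  apply: nbhs_forall => i; apply: nbhs_forall => j.
  apply: (near_imp) => iS; apply: (near_imp) => jS; have [h1 h2] := x3 i j iS jS.
  apply: filterI; first by apply: (near_lt); [exact: cny|exact: cy|].
  apply: (near_lt); [exact: cny| |exact: h2].
  by move=> z; exact: (cvgB (cst 1 z) (cy j z)).
by apply: filterS (filterI n1 (filterI n2 n3)) => z [z1 [z2 z3]].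
Qed.

Lemma handle_diam Sk x x' : handle Sk x -> handle Sk x' -> linf (x - x') <= delta.
Proof.
case: Sk => S k [_ [x1 [x2 _]]] [_ [x1' [x2' _]]]; rewrite /linf.
apply: bigmax_le => [|i _]; first exact: ltW.
have -> : (x - x') 0 i = delta * (y x i - y x' i).
  rewrite !mxE /y -mulrBl mulrC divfK ?gt_eqF//; lra.
have yy : `|y x i - y x' i| <= 1.
  have [iS|iS] := boolP (i \in S).
    by have := x1 i iS; have := x1' i iS; rewrite /= !ltr_norml ler_norml; lra.
  by have := x2 i iS; have := x2' i iS; rewrite /= ler_norml; lra.
by rewrite normrM gtr0_norm// ler_piMr// ltW.
Qed.

(** Take for [S] the coordinates lying exactly on the grid: they are at distance 0 from it and all
    others at positive distance. General position bounds the size of [S]. *)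
Lemma handle_cover (x : 'rV[R]_N) :
  (forall (S : {set 'I_N}) (k : 'I_N -> int),
    (forall i, i \in S -> x 0 i - a i = delta * (k i)%:~R) -> (#|S| <= d)%N) ->
  exists Sk, handle Sk x.
Proof.
move=> gen; pose k := [ffun i => Num.floor (y x i)].
pose S := [set i | y x i == (k i)%:~R]%SET.
have S0 i : i \in S -> y x i - (k i)%:~R = 0 by rewrite inE => /eqP ->; rewrite subrr.
have S1 j : j \notin S -> 0 < y x j - (k j)%:~R < 1.
  rewrite inE => nj; have kj : k j = Num.floor (y x j) by rewrite ffunE.
  have := floor_itv (y x j); rewrite -kj intrD => /andP[h1 h2].
  by rewrite subr_gt0 ltrBlDl h2 andbT lt_neqAle eq_sym nj.
exists (S, k); split; [|split; [|split]] => /=.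
- apply: (gen S k) => i iS; have := S0 i iS => /eqP; rewrite subr_eq0 => /eqP <-.
  by rewrite /y mulrC divfK ?gt_eqF.
- by move=> i /S0 ->; rewrite normr0; lra.
- exact: S1.
- by move=> i j /S0 -> /S1/andP[h1 h2]; rewrite normr0; lra.
Qed.

Let int_sep (m m' : int) : m = m' \/ (m%:~R + 1 <= m'%:~R :> R) \/ (m'%:~R + 1 <= m%:~R :> R).
Proof.
have -> : (m%:~R + 1 <= m'%:~R :> R) = (m + 1 <= m') by rewrite -(ler_int R) intrD.
have -> : (m'%:~R + 1 <= m%:~R :> R) = (m' + 1 <= m) by rewrite -(ler_int R) intrD.
by rewrite !lezD1; case: (ltgtP m m') => h; [right; left|right; right|left].
Qed.

(** A handle forces the coordinates in [S] to be strictly nearer to the integers than those outside.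
    If two sets of equal size differ, some [i] and [j] are exchanged between them and yield opposite
    strict inequalities; once the sets agree, the integers are determined by the inequalities. *)
Lemma handle_disjoint (Sk Sk' : {set 'I_N} * {ffun 'I_N -> int}) x : #|Sk.1| = #|Sk'.1| ->
  handle Sk x -> handle Sk' x -> Sk = Sk'.
Proof.
case: Sk Sk' => [S k] [S' k'] /= SS' [_ [/= x1 [x2 x3]]] [_ [/= x1' [x2' x3']]].
have eS : S = S'.
  apply/eqP; rewrite eqEcard SS' leqnn andbT; apply/fintype.subsetP => i iS.
  apply/negPn/negP => iS'.
  have [j jS' jS] : exists2 j, j \in S' & j \notin S.
    apply/fintype.subsetPn; apply/negP => S'S.
    have /eqP e : S' == S by rewrite eqEcard S'S SS' leqnn.
    by rewrite e iS in iS'.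
  have [h1 h2] := x3 i j iS jS; have [h1' h2'] := x3' j i jS' iS'.
  have := x2 j jS; have := x2' i iS'.
  move: (int_sep (k i) (k' i)) (int_sep (k j) (k' j)) h1 h2 h1' h2'.
  rewrite !ltr_norml => e1 e2.
  by case: e1 => [->|[]]; case: e2 => [->|[]]; lra.
rewrite -eS in x1' x2' *; congr pair; apply/ffunP => i.
have [iS|iS] := boolP (i \in S).
  have := x1 i iS; have := x1' i iS; rewrite !ltr_norml => h1 h2.
  by case: (int_sep (k i) (k' i)) => [//|h]; exfalso; move: h => []; lra.
have h1 := x2 i iS; have h2 := x2' i iS.
by case: (int_sep (k i) (k' i)) => [//|h]; exfalso; move: h => []; lra.
Qed.
End ColoredCover.

(** * The cover by path components *)

Lemma finite_set_enum (T : Type) (F : set (set T)) : finite_set F ->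
  exists (r : nat) (V : 'I_r -> set T), injective V /\ range V = F.
Proof.
move=> /finite_seqP[s ->]; pose u := undup s.
exists (size u), (tnth (in_tuple u)); split.
  by apply/tuple_uniqP; exact: undup_uniq.
apply/seteqP; split=> [_ [i _ <-]|A /=].
  by rewrite /= -mem_undup; exact: mem_tnth.
by rewrite -mem_undup => /(@tnthP _ _ (in_tuple u))[i ->]; exists i.
Qed.

Section ComponentCover.
Variables (R : realType) (n N d : nat) (M K : set 'rV[R]_N).
Variables (phi : 'rV[R]_N -> 'rV[R]_N) (delta : R).
Hypothesis M_mfd : closed_C1_submanifold n M.
Hypothesis K_poly : polyhedron d K.
Hypothesis phi_cont : {within M, continuous phi}.
Hypothesis phi_in : phi @` M `<=` K.
Hypothesis delta0 : 0 < delta.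

(** The sets are path components of preimages of handles: open in [M] by local path connectedness,
    and finitely many suffice by compactness. *)
Lemma component_cover : exists (r : nat) (V : 'I_r -> set 'rV[R]_N) (col : 'I_r -> 'I_d.+1),
  (forall j, V j `<=` M) /\
  (forall j x, V j x -> nbhs x [set z | M z -> V j z]) /\
  (forall x, M x -> exists j, V j x) /\
  (forall j x y, V j x -> V j y -> joined R (V j) x y) /\
  (forall i j x, V i x -> V j x -> col i = col j -> i = j) /\
  (forall j x y, V j x -> V j y -> linf (phi x - phi y) <= delta).
Proof.
(* The polyhedron may be unbounded, so general position is asked only near the compact image of
   [phi]. *)
have [rho _ rhoP] := pinfty_ex_gt0 (compact_bounded (continuous_compact phi_cont M_mfd.1)).
have [|a aP] := @generic_shift R N d K (phi @` M) rho delta K_poly phi_in.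
  by move=> x Cx; rewrite linfE; exact: rhoP.
have /choice[sk skP] : forall x, exists Sk, M x -> handle d a delta Sk (phi x).
  move=> x; have [Mx|nMx] := pselect (M x); last by exists (finset.set0, [ffun=> 0]).
  have [|Sk h] := @handle_cover R N d a delta delta0 (phi x); last by exists Sk.
  by move=> S k xS; apply: (aP (phi x) S k) => //; exists x.
pose G Sk : set 'rV[R]_N := M `&` [set z | handle d a delta Sk (phi z)].
pose C x : set 'rV[R]_N := joined R (G (sk x)) x.
have CG x z : C x z -> G (sk x) z by move=> Cxz; have [] := joined_in Cxz.
have Cxx x : M x -> C x x by move=> Mx; apply: joined_refl; split=> //; exact: skP.
have C_open x y : C x y -> nbhs y [set z | M z -> C x z].
  move=> Cxy; have [My hy] := CG _ _ Cxy.
  have nO : nbhs y [set z | M z -> handle d a delta (sk x) (phi z)].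
    move/within_continuousP : phi_cont; apply=> //.
    by apply: open_nbhs_nbhs; split=> //; exact: handle_open.
  have [P nP [PJ _]] := locally_contractible M_mfd My nO.
  apply: filterS nP => z Pz Mz; apply: joined_trans Cxy _.
  by apply: joined_mono (PJ z Mz Pz) => u [Mu /(_ Mu)].
have [D [finD DM Dcov]] : exists D : set 'rV[R]_N, [/\ finite_set D, D `<=` M &
    M `<=` cover D (fun x => interior [set z | M z -> C x z])].
  suff : finite_subset_cover M (fun x => interior [set z | M z -> C x z]) M.
    move=> [D DM Dcov]; exists (fun x => x \in finmap.enum_fset D); split=> //.
      exact: finite_fset.
    by move=> x /DM/set_mem.
  have := M_mfd.1; rewrite compact_cover; apply.
    by move=> x _; exact: open_interior.
  by move=> x Mx; exists x => //; apply: C_open; exact: Cxx.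
(* Different centres may give the same component. Enumerating the components without repetition lets
   equality of sets yield equality of indices, as the colouring property demands. *)
have [|r [V [V_inj V_rng]]] := @finite_set_enum 'rV[R]_N (C @` D).
  exact: finite_image.
have /choice[pt ptP] : forall j, exists x, M x /\ V j = C x.
  move=> j; have : (C @` D) (V j) by rewrite -V_rng; exists j.
  by move=> [x xD <-]; exists x; split=> //; exact: DM.
have VG j z : V j z -> G (sk (pt j)) z by have [_ ->] := ptP j; exact: CG.
have skd j : (#|(sk (pt j)).1| <= d)%N by have [/skP[]] := ptP j.
(* The colour is the number of coordinates held on the grid, between 0 and [d], so [inord] loses
   nothing. *)
exists r, V, (fun j => inord #|(sk (pt j)).1|); do !split.
- by move=> j z /VG[].
- by move=> j x; have [_ ->] := ptP j; exact: C_open.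
- move=> x Mx; have [y yD /interior_subset yx] := Dcov x Mx.
  have : (C @` D) (C y) by exists y.
  rewrite -V_rng => -[j _ Vj]; by exists j; rewrite Vj; exact: yx.
- move=> j x y; have [_ ->] := ptP j => /joined_component Cx /joined_component Cy.
  exact: joined_trans (joined_sym Cx) Cy.
- move=> i j x Vi Vj /(congr1 val) /=; rewrite !inordK ?ltnS// => e.
  have [Mx hi] := VG _ _ Vi; have [_ hj] := VG _ _ Vj.
  have eS := handle_disjoint e hi hj.
  apply: V_inj; move: Vi Vj; have [_ ->] := ptP i; have [_ ->] := ptP j.
  rewrite /C -eS => Ci Cj.
  have ij := joined_trans Ci (joined_sym Cj).
  by apply/seteqP; split=> z; apply: joined_trans => //; exact: joined_sym.
- move=> j x y /VG[_ hx] /VG[_ hy]; exact: handle_diam hx hy.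
Qed.
End ComponentCover.

(** * Non-contractible loops in cubes and passage to the infimum *)

Lemma noncontractible_loop_in_cube (R : realType) (n N : nat) (M K : set 'rV[R]_N)
    (phi : 'rV[R]_N -> 'rV[R]_N) (w eps : R) :
  closed_C1_submanifold n M -> essential n M -> polyhedron n.-1 K ->
  {within M, continuous phi} -> phi @` M `<=` K ->
  (forall x, M x -> linf (x - phi x) <= w) -> 0 < eps ->
  exists g : R -> 'rV[R]_N, loop_in M g /\ ~ contractible_in M g /\
    exists c : 'rV[R]_N, forall t, I01 t -> linf (g t - c) <= w + eps.
Proof.
move=> M_mfd [_ ess] K_poly phi_cont phi_in phi_w eps0.
apply: contrapT => nex.
have eps20 : 0 < eps / 2 by rewrite divr_gt0.
(* The diameter [eps / 2] is chosen because two steps of the cover are made between [u] and a point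
   of the loop. *)
have [r [V [col [V_sub [V_open [V_cover [V_joined [V_col V_diam]]]]]]]] :=
  component_cover M_mfd K_poly phi_cont phi_in eps20.
apply: (ess r (nerve M V) (nerve_map M V)).
- exact: nerve_polyhedron V_col.
- exact: nerve_map_continuous.
- by move=> _ [x Mx <-]; exact: nerve_map_in.
apply: nerve_map_pi1_iso => // u l Mu [cl [l01 lu]].
have luP t : I01 t -> M (l t) /\ linf (l t - phi u) <= w + eps.
  move=> tI; have [|z [j [Vu Vz]] [j' [Vz' Vt]]] := lu (l t); first by exists t.
  have Mt := V_sub _ _ Vt; split=> //.
  have := V_diam _ _ _ Vu Vz; have := V_diam _ _ _ Vz' Vt; have := phi_w _ Mt.
  rewrite !linfE => h1 h2 h3.
  (* One term bounded by [w] for the displacement of [l t], and two bounded by [eps / 2] for the two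
     steps through [z]; the cube is centred at [phi u]. *)
  have -> : l t - phi u = (l t - phi (l t)) - (phi z - phi (l t)) - (phi u - phi z).
    by rewrite opprB addrA subrK opprB addrA subrK.
  have := ler_normB (l t - phi (l t) - (phi z - phi (l t))) (phi u - phi z).
  by have := ler_normB (l t - phi (l t)) (phi z - phi (l t)); lra.
apply: contrapT => nl; apply: nex; exists l; split; last split=> //.
  by split=> //; split=> // _ [t tI <-]; have [] := luP t tI.
by exists (phi u) => t tI; have [] := luP t tI.
Qed.

(** Provides one admissible competitor, so that the infimum defining the width is over a non-empty
    set. *)
Lemma point_polyhedron (R : realType) (N d : nat) (p : 'rV[R]_N) : polyhedron d [set p].
Proof.
exists unit, (fun=> 0%N), (fun _ _ => p); split=> //; split; [|split].
- by move=> _; rewrite /aff_indep /row_free; apply/eqP; apply/eqP; rewrite -leqn0 rank_leq_row.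
- apply/seteqP; split=> [_ ->|x [_ _ [t [_ [t1 ->]]]]].
    exists tt => //; exists (fun=> 1); split=> //.
    by rewrite !big_ord1 scale1r.
  by rewrite /= -scaler_suml t1 scale1r.
- by move=> c; exact: finite_finset.
Qed.

Theorem theorem1p6 (R : realType) (n N : nat) (M : set 'rV[R]_N) :
  closed_C1_submanifold n M -> connected M -> essential n M ->
  exists g : R -> 'rV[R]_N,
    loop_in M g /\ ~ contractible_in M g /\
    exists c : 'rV[R]_N, forall t, I01 t -> linf (g t - c) <= 2 * W_linf n M.
Proof.
move=> M_mfd _ ess; set W := W_linf n M.
have [x0 Mx0] : exists x, M x.
  have [[g [[_ [_ gM]] _]] _] := ess; exists (g 0); apply: gM; exists 0 => //.
  exact: I01_0.
pose D (phi : 'rV[R]_N -> 'rV[R]_N) := [set linf (x - phi x) | x in M].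
(* Compactness of [M] bounds the displacement, so the [sup] in the width really dominates every
   [linf (x - phi x)]. *)
have D_sup phi : {within M, continuous phi} -> has_sup (D phi).
  move=> cphi; split; first by exists (linf (x0 - phi x0)); exists x0.
  have cid_phi : {within M, continuous (fun x => x - phi x)}.
    by apply: withinB => //; exact: within_id.
  have [rho _ rhoP] := pinfty_ex_gt0 (compact_bounded (continuous_compact cid_phi M_mfd.1)).
  by exists rho => _ [x Mx <-]; rewrite linfE; apply: rhoP; exists x.
have linf_ge0 (x : 'rV[R]_N) : 0 <= linf x by rewrite linfE.
pose Ws := [set r : R | exists (K : set 'rV[R]_N) (phi : 'rV[R]_N -> 'rV[R]_N),
  polyhedron (n.-1) K /\ {within M, continuous phi} /\ phi @` M `<=` K /\
  r = sup (D phi)].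
have Ws_ge0 : lbound Ws 0.
  move=> _ [K [phi [_ [cphi [_ ->]]]]].
  apply: le_trans (linf_ge0 (x0 - phi x0)) _.
  by apply: sup_upper_bound; [exact: D_sup|exists x0].
have Ws_inf : has_inf Ws.
  split; last by exists 0.
  exists (sup (D (fun=> 0))), [set 0], (fun=> 0); split; first exact: point_polyhedron.
  by split; [exact: within_cst|split=> // _ [x _ <-]].
have W0 : 0 <= W by apply: lb_le_inf => //; exact: Ws_inf.1.
have loop e : 0 < e -> exists g : R -> 'rV[R]_N,
    loop_in M g /\ ~ contractible_in M g /\
    exists c : 'rV[R]_N, forall t, I01 t -> linf (g t - c) <= W + e.
  move=> e0; have e20 : 0 < e / 2 by rewrite divr_gt0.
  (* Half of [e] pays for a competitor that does not attain the infimum, the other half for the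
     grid. *)
  have [_ [K [phi [pK [cphi [phiK ->]]]]] phiW] := inf_adherent e20 Ws_inf.
  have [|g [lg [ng [c gc]]]] := noncontractible_loop_in_cube (w := sup (D phi))
    M_mfd ess pK cphi phiK _ e20.
    by move=> x Mx; apply: sup_upper_bound; [exact: D_sup|exists x].
  exists g; do 2!split=> //; exists c => t /gc h; apply: le_trans h _.
  by move: phiW; rewrite -/W; lra.
have [W_gt0|W_le0] := ltP 0 W.
  have [g [lg [ng [c gc]]]] := loop W W_gt0.
  by exists g; do 2!split=> //; exists c => t /gc; rewrite mulrDl mul1r.
have [e e0 small] := small_loops_contractible M_mfd.
have [g [lg [ng [c gc]]]] := loop e e0.
exfalso; apply: ng; apply: (small g c) => // t /gc.
have -> : W = 0 by apply/le_anti; rewrite W0 W_le0.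
by rewrite add0r.
Qed.
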